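(* Let $\Omega\subset\mathcal{A}^{\mathbb{Z}_+}$ and $\Sigma\subset\mathcal{B}^{\mathbb{Z}_+}$ be mixing subshifts of finite type, and let $\pi:\Omega\to\Sigma$ be a (surjective) $1$-block factor map which is fibre mixing. Let $\mu$ be a stationary Markov measure on $\Omega$ whose transition matrix $P$ is compatible with $\Omega$. Then $\mu$ admits a continuous measure disintegration with respect to $\pi$, and hence $\nu=\mu\circ\pi^{-1}$ is a $g$-measure on $\Sigma$.
   Context: $\mathbb{Z}_+=\{0,1,2,\ldots\}$. $\mathcal{A},\mathcal{B}$ are finite sets with $|\mathcal{A}|>|\mathcal{B}|$ and $\pi:\mathcal{A}\to\mathcal{B}$ is surjective; the same symbol denotes the induced map $\pi:\mathcal{A}^{\mathbb{Z}_+}\to\mathcal{B}^{\mathbb{Z}_+}$, $\pi(x)_n=\pi(x_n)$ (a $1$-block factor map), and its restriction $\Omega\to\Sigma=\pi(\Omega)$. For a $0/1$ matrix $M$ indexed by $\mathcal{A}\times\mathcal{A}$, the subshift of finite type (SFT) is $\Omega_M=\{x\in\mathcal{A}^{\mathbb{Z}_+}:M(x_n,x_{n+1})=1\ \forall n\ge0\}$ with the product topology; it is mixing if $M$ is primitive, i.e. $M^n>0$ entrywise for some $n>0$. Here $\Omega=\Omega_M$ and $\Sigma=\Sigma_{M'}$ for a $0/1$ matrix $M'$ indexed by $\mathcal{B}\times\mathcal{B}$. A stochastic matrix $P$ is compatible with $\Omega_M$ if $P_{ij}>0\iff M(i,j)=1$. The fibre over $y\in\Sigma$ is $\Omega_y=\{x\in\Omega:\pi(x)=y\}$.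 The map $\pi$ is fibre mixing if for all $y\in\Sigma$, all $x,\tilde x\in\Omega_y$ and every $n\in\mathbb{Z}_+$ there exist $\hat x\in\Omega_y$ and $m\in\mathbb{Z}_+$ such that $\hat x_i=x_i$ for $0\le i\le n$ and $\hat x_i=\tilde x_i$ for all $i\ge n+m$. A disintegration of $\mu$ with respect to $\pi$ is a family $\{\mu_y\}_{y\in\Sigma}$ of Borel probability measures with $\mu_y(\Omega_y)=1$ such that for all $f\in L^1(\Omega,\mu)$ the map $y\mapsto\int_{\Omega_y}f\,d\mu_y$ is measurable and $\int_\Omega f\,d\mu=\int_\Sigma\int_{\Omega_y}f(x)\,\mu_y(dx)\,\nu(dy)$. It is a continuous measure disintegration if $y\mapsto\int_{\Omega_y}f\,d\mu_y$ is continuous on $\Sigma$ for every continuous $f:\Omega\to\mathbb{R}$. $g$-measures: let $by$ denote the sequence $(b,y_0,y_1,\ldots)$ and let $\mathcal{G}(\Sigma)$ be the set of continuous $g:\Sigma\to(0,1]$ with $\sum_{b\in\mathcal{B}:\,by\in\Sigma}g(by)=1$ for all $y\in\Sigma$. A translation-invariant probability measure $\nu$ on $\Sigma$ is a $g$-measure if there is $g\in\mathcal{G}(\Sigma)$ with $\nu(y_0\mid y_1,y_2,\ldots)=g(y)$ for $\nu$-a.e. $y\in\Sigma$, where the left side is the conditional probability that the $0$-th coordinate is $y_0$ given the coordinates $1,2,\ldots$. *)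

(* Defs.v *)
From HB Require Import structures.
From mathcomp Require Import all_boot all_order all_algebra.
From mathcomp Require Import all_classical all_reals all_analysis.
From mathcomp Require Import measurable_realfun.

Set Implicit Arguments.
Unset Strict Implicit.
Unset Printing Implicit Defensive.
Import Order.TTheory GRing.Theory Num.Theory.
Import numFieldNormedType.Exports.

Local Open Scope classical_set_scope.
Local Open Scope ring_scope.

(* Alphabets: finite nonempty sets.  The distinguished point is never used; it
   is there because measurable types are pointed in MathComp-Analysis. *)
#[short(type="alphabetType")]
HB.structure Definition Alphabet := {T of Finite T & Pointed T}.

(* One-sided sequences over T: product of the discrete topologies, with the
   Borel sigma-algebra. *)
Definition seqspace (T : Type) : Type :=
  prod_topology (fun _ : nat => discrete_topology T).

HB.instance Definition _ (T : alphabetType) := Pointed.on (seqspace T).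
HB.instance Definition _ (T : alphabetType) := Topological.on (seqspace T).
HB.instance Definition _ (T : alphabetType) :=
  @isMeasurable.Build (sigma_display (@open (seqspace T))) (seqspace T)
    <<s open >> (@sigma_algebra0 _ setT open) (@sigma_algebraC _ open)
    (@sigma_algebra_bigcup _ setT open).

Definition shift (T : Type) (x : seqspace T) : seqspace T := fun n => x n.+1.

Definition scons (T : Type) (a : T) (x : seqspace T) : seqspace T :=
  fun n => if n is m.+1 then x m else a.

Definition block_map (A B : Type) (p : A -> B) (x : seqspace A) : seqspace B :=
  fun n => p (x n).

Lemma cvg_prod_topology (I : eqType) (K : I -> topologicalType)
    (F : set_system (prod_topology K)) (f : prod_topology K) :
  Filter F -> (forall i, proj i @ F --> f i) -> F --> f.
Proof.
move=> FF Ff; apply/cvg_sup => i U [_ [[V oV <-] Vfi] sU].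
by apply: filterS sU _; apply: (Ff i); exact: open_nbhs_nbhs.
Qed.

Lemma block_map_continuous (A B : alphabetType) (p : A -> B) :
  continuous (block_map p).
Proof.
move=> x.
have FF : Filter (nbhs x) by exact: nbhs_filter.
have FF' : Filter (block_map p @ x) by exact: fmap_filter.
refine (@cvg_prod_topology nat (fun=> discrete_topology B)
  (block_map p @ x) (block_map p x) FF' _) => t.
move=> U /principal_filterP Ub; rewrite /= nbhs_simpl.
apply: (@filterS _ _ _ (@proj nat (fun=> A) t @^-1` [set x t])).
  by move=> y /= yx; rewrite /proj /block_map -[y t]/(proj t y) yx.
refine (@proj_continuous nat (fun=> discrete_topology A) t x _ _).
exact: (@discrete_set1 (discrete_topology A)).
Qed.

Lemma measurable_block_map (A B : alphabetType) (p : A -> B) :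
  measurable_fun [set: seqspace A] (block_map p).
Proof.
apply: (@measurability _ _ (seqspace A) (seqspace B) _ _ open) => //.
move=> _ [U oU <-]; rewrite setTI; apply: sub_sigma_algebra.
by apply: open_comp => // x _; exact: block_map_continuous.
Qed.

HB.instance Definition _ (A B : alphabetType) (p : A -> B) :=
  isMeasurableFun.Build _ _ (seqspace A) (seqspace B) (block_map p)
    (measurable_block_map p).

(* 0/1 matrices indexed by T x T are boolean relations on T. *)
Definition SFT (T : Type) (M : rel T) : set (seqspace T) :=
  [set x | forall n, M (x n) (x n.+1)].

Definition incidence_mx (T : finType) (M : rel T) : 'M[nat]_#|T| :=
  \matrix_(i, j) (M (enum_val i) (enum_val j) : nat).

Definition primitive (T : finType) (M : rel T) : Prop :=
  exists2 n, (0 < n)%N & forall i j, (0 < (incidence_mx M ^+ n) i j)%N.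

Section fibres.
Variables (A B : Type) (Omega : set (seqspace A)) (p : A -> B).

Definition fibre (y : seqspace B) : set (seqspace A) :=
  [set x | Omega x /\ block_map p x = y].

Definition fibre_mixing : Prop :=
  forall y, (block_map p @` Omega) y ->
  forall x x', fibre y x -> fibre y x' ->
  forall n : nat, exists x'' (m : nat),
    [/\ fibre y x'',
        forall i, (i <= n)%N -> x'' i = x i &
        forall i, (n + m <= i)%N -> x'' i = x' i].

End fibres.

Section markov.
Variables (R : realType) (A : alphabetType).
Implicit Types (P : A -> A -> R) (M : rel A).

Definition stochastic P : Prop :=
  (forall i j, 0 <= P i j) /\ (forall i, \sum_j P i j = 1).

Definition compatible P M : Prop := forall i j, 0 < P i j <-> M i j.

Definition stationary_vector P (q : A -> R) : Prop :=
  [/\ forall i, 0 <= q i, \sum_i q i = 1 &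
      forall j, \sum_i q i * P i j = q j].

Definition cylinder (n : nat) (w : nat -> A) : set (seqspace A) :=
  [set x | forall i, (i <= n)%N -> x i = w i].

Definition stationary_markov (mu : probability (seqspace A) R) P : Prop :=
  stochastic P /\
  exists2 q, stationary_vector P q &
    forall n w,
      mu (cylinder n w) = (q (w 0%N) * \prod_(i < n) P (w i) (w i.+1))%:E.

End markov.

Section disintegration.
Variables (R : realType) (A B : alphabetType) (p : A -> B).
Variables (Omega : set (seqspace A)) (Sigma : set (seqspace B)).

(* Extended-real valued, as f in L^1(mu) need not be mu_ y-integrable for y in a
   null set. *)
Definition fibre_integral (mu_ : seqspace B -> probability (seqspace A) R)
    (f : seqspace A -> R) (y : seqspace B) : \bar R :=
  (\int[mu_ y]_(x in fibre Omega p y) (f x)%:E)%E.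

(* The values of mu_ outside Sigma are irrelevant. *)
Definition disintegration (mu : probability (seqspace A) R)
    (mu_ : seqspace B -> probability (seqspace A) R) : Prop :=
  (forall y, Sigma y -> mu_ y (fibre Omega p y) = 1%E) /\
  forall f : seqspace A -> R, mu.-integrable Omega (EFin \o f) ->
    measurable_fun Sigma (fibre_integral mu_ f) /\
    (\int[mu]_(x in Omega) (f x)%:E =
     \int[distribution mu (block_map p)]_(y in Sigma) fibre_integral mu_ f y)%E.

Definition continuous_disintegration (mu : probability (seqspace A) R)
    (mu_ : seqspace B -> probability (seqspace A) R) : Prop :=
  disintegration mu mu_ /\
  forall f : seqspace A -> R, {within Omega, continuous f} ->
    {within Sigma, continuous
      (fun y => \int[mu_ y]_(x in fibre Omega p y) f x)}.

End disintegration.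

(* h is a version of the conditional probability of E given the sigma-algebra
   generated by f. *)
Definition cond_prob (R : realType) d d' (T : measurableType d)
    (T' : measurableType d') (nu : probability T R) (f : T -> T')
    (E : set T) (h : T -> R) : Prop :=
  [/\ measurable_fun [set: g_sigma_algebra_preimageType f] h,
      nu.-integrable [set: T] (EFin \o h) &
      forall C, g_sigma_algebra_preimage f C ->
        (\int[nu]_(x in C) (h x)%:E = nu (E `&` C))%E].

Section g_measures.
Variables (R : realType) (B : alphabetType) (Sigma : set (seqspace B)).

Definition translation_invariant (nu : probability (seqspace B) R) : Prop :=
  forall C, measurable C -> nu (@shift B @^-1` C) = nu C.

Definition g_function (g : seqspace B -> R) : Prop :=
  [/\ {within Sigma, continuous g},
      forall y, Sigma y -> 0 < g y <= 1 &
      forall y, Sigma y ->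
        \sum_(b : B | scons b y \in Sigma) g (scons b y) = 1].

(* The coordinates 1, 2, ... generate the same sigma-algebra as the shift. *)
Definition g_measure (nu : probability (seqspace B) R) : Prop :=
  [/\ nu Sigma = 1%E, translation_invariant nu &
      exists2 g, g_function g &
        exists c : B -> seqspace B -> R,
          (forall b, cond_prob nu (@shift B) [set y | y 0%N = b] (c b)) /\
          {ae nu, forall y, Sigma y -> c (y 0%N) y = g y}].

End g_measures.

(* Main.v *)
(* Conditioning the Markov measure on the window y_0 ... y_n amounts to pushing
   row vectors through the blocks of P over y_k -> y_{k+1}.  Fibre mixing and
   compactness give a length N for which every product of N consecutive blocks
   is positive on a full rectangle of rows and columns; its positive entries are
   bounded below, so it contracts ratios of vectors by a fixed factor.  Hence
   the conditional probabilities of a cylinder given y_0 ... y_n converge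
   uniformly in y, and their limits, which are continuous in y, define the fibre
   measures.  With b(a, c) = q_a P_ac / q_c the reversed transitions, the
   function g(y) = sum_c (sum_(p a = y_0) b(a, c)) mu_(shift y)[x_0 = c] is then
   a continuous version of nu(y_0 | y_1, y_2, ...), and it is positive because
   mu_y charges every letter that starts a point of the fibre. *)

Require Import Defs.
From HB Require Import structures.
From mathcomp Require Import all_boot all_order all_algebra.
From mathcomp Require Import all_classical all_reals all_analysis.
From mathcomp Require Import measurable_realfun giry.
From mathcomp Require Import ring lra.
Set Implicit Arguments.
Unset Strict Implicit.
Unset Printing Implicit Defensive.
Import Order.TTheory GRing.Theory Num.Theory.
Import numFieldNormedType.Exports.
Local Open Scope classical_set_scope.
Local Open Scope ring_scope.

(** * Finitary sets of sequences *)

(** Fibre mixing gives a weaker property: over [N] steps, every starting letter that survives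
    reaches every final letter that can be reached at all. This is enough because two vectors are
    compared, the law of a cylinder on the window and the law of the window itself. The same blocks
    move both, so dead letters drop out of both and only bounds on their quotient are tracked. The
    contraction rate depends on [P] and [N] alone. This uniformity makes the limit continuous, as
    each approximation is a locally constant function of y. Primitivity enters through q > 0: every
    window of a point of Sigma has positive mass, so the fibre measures exist at every point and not
    merely almost everywhere. Countable additivity of the limits follows from compactness of clopen
    sets. *)

Lemma konig (T : finType) (D : nat -> set (nat -> T)) :
  (forall n, D n.+1 `<=` D n) ->
  (forall n x x', (forall i, (i <= n)%N -> x i = x' i) -> D n x -> D n x') ->
  (forall n, D n !=set0) -> exists x, forall n, D n x.
Proof.
move=> decD finD D0.
have subD m n : (m <= n)%N -> D n `<=` D m.
  move=> /subnK <-; elim: (n - m)%N => // k IH x /decD; exact: IH.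
pose good n u := forall N, exists2 x, D N x & forall i, (i < n)%N -> x i = u i.
pose upd n (u : nat -> T) a := fun i => if i == n then a else u i.
(* The implication sits under the existential so that [choice] gives a total function; a prefix that
   is not good receives an arbitrary letter. *)
have step (nu : nat * (nat -> T)) :
    exists a, good nu.1 nu.2 -> good nu.1.+1 (upd nu.1 nu.2 a).
  case: nu => n u /=; have [x0 _] := D0 0%N.
  have [gu|] := pselect (good n u); last by exists (x0 0%N).
  apply: contrapT => /forallNP noa.
  have {}noa a : exists N, forall x, D N x ->
      ~ (forall i, (i < n.+1)%N -> x i = upd n u a i).
    apply: contrapT => /forallNP noN; apply: (noa a) => _ N.
    apply: contrapT => /forall2NP H; apply: (noN N) => x Dx xu.
    by case: (H x).
  have [N HN] := choice noa.
  (* Pigeonhole on the finite alphabet: past the largest failure stage, the letter [x n] of an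
     actual point contradicts its own failure. *)
  have [x Dx xu] := gu (\max_a N a)%N.
  apply: (HN (x n) x); first by apply: subD Dx; exact: leq_bigmax.
  move=> i; rewrite ltnS /upd; case: eqP => [->//|/eqP ne le].
  by apply: xu; rewrite ltn_neqAle ne.
have [next Hnext] := choice step.
have [x0 _] := D0 0%N.
pose U := fix U n := if n is k.+1 then upd k (U k) (next (k, U k)) else x0.
have gU n : good n (U n).
  elim: n => [N|n IH]; last exact: (Hnext (n, U n)).
  by have [x Dx] := D0 N; exists x.
pose x n := U n.+1 n.
have Ux n i : (i < n)%N -> U n i = x i.
  elim: n => // n IH; rewrite ltnS leq_eqVlt => /orP[/eqP -> //|lt].
  by rewrite /= {1}/upd ltn_eqF// IH.
exists x => n; have [x' Dx' x'U] := gU n.+1 n.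
by apply: finD Dx' => i le; rewrite x'U// Ux.
Qed.

(** One implication suffices, agreement up to [n] being symmetric. Over a finite alphabet these are
    the clopen sets. *)
Definition finitary (T : Type) n (C : set (seqspace T)) : Prop :=
  forall x x', (forall i, (i <= n)%N -> x i = x' i) -> C x -> C x'.

Section finitary.
Variable T : Type.
Implicit Types C D : set (seqspace T).

Lemma finitary_le m n C : (m <= n)%N -> finitary m C -> finitary n C.
Proof.
by move=> mn fC x x' xx'; apply: fC => i im; apply: xx'; exact: leq_trans mn.
Qed.

Lemma finitaryC n C : finitary n C -> finitary n (~` C).
Proof. by move=> fC x x' xx' nC C'; apply: nC; apply: fC C' => i /xx' ->. Qed.

Lemma finitaryI n C D : finitary n C -> finitary n D -> finitary n (C `&` D).
Proof. by move=> fC fD x x' xx' [/(fC _ _ xx') ? /(fD _ _ xx') ?]. Qed.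

Lemma finitary_coord n (P : set T) : finitary n [set x | P (x n)].
Proof. by move=> x x' /(_ n (leqnn n)) /= ->. Qed.

Definition is_finitary : set (set (seqspace T)) := [set C | exists n, finitary n C].

Lemma is_finitary_setI C D :
  is_finitary C -> is_finitary D -> is_finitary (C `&` D).
Proof.
move=> [m fC] [n fD]; exists (maxn m n); apply: finitaryI.
  by apply: finitary_le fC; exact: leq_maxl.
by apply: finitary_le fD; exact: leq_maxr.
Qed.

Lemma is_finitary_setC C : is_finitary C -> is_finitary (~` C).
Proof. by move=> [n fC]; exists n; exact: finitaryC. Qed.

Lemma is_finitary_setU C D :
  is_finitary C -> is_finitary D -> is_finitary (C `|` D).
Proof.
move=> fC fD; rewrite -[X in is_finitary X]setCK setCU.
by apply/is_finitary_setC/is_finitary_setI; exact: is_finitary_setC.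
Qed.

Lemma is_finitary_setT : is_finitary [set: seqspace T].
Proof. by exists 0%N. Qed.

Lemma is_finitary_set0 : is_finitary (@set0 (seqspace T)).
Proof. by exists 0%N. Qed.

End finitary.

Lemma finitary_block_map (A B : Type) (p : A -> B) n (D : set (seqspace B)) :
  finitary n D -> finitary n (block_map p @^-1` D).
Proof.
by move=> fD x x' xx'; apply: fD => i /xx' e; rewrite /block_map e.
Qed.

Lemma finitary_shift (T : Type) n (D : set (seqspace T)) :
  finitary n D -> finitary n.+1 (@Defs.shift T @^-1` D).
Proof. by move=> fD x x' xx'; apply: fD => i; exact: (xx' i.+1). Qed.

Section cylinders.
Variable T : alphabetType.
Implicit Types x : seqspace T.

Lemma finitary_cylinder n (w : nat -> T) : finitary n (cylinder n w).
Proof. by move=> x x' xx' xw i ni; rewrite -xx'// xw. Qed.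

Lemma nbhs_coord n x : nbhs x [set x' : seqspace T | x' n = x n].
Proof.
exact: (@proj_continuous nat (fun=> discrete_topology T) n x _
  (@discrete_set1 (discrete_topology T) (x n))).
Qed.

Lemma nbhs_cylinder n x : nbhs x (cylinder n x).
Proof.
elim: n => [|n IH].
  by apply: filterS (nbhs_coord 0 x) => x' /= e i; rewrite leqn0 => /eqP ->.
apply: filterS (filterI IH (nbhs_coord n.+1 x)) => x' /= [cx e] i.
by rewrite leq_eqVlt => /orP[/eqP -> //|]; exact: cx.
Qed.

(** The cylinders around [x] generate a filter converging to [x] in each coordinate, hence in the
    product topology. *)
Lemma nbhs_sub_cylinder x (U : set (seqspace T)) :
  nbhs x U -> exists n, cylinder n x `<=` U.
Proof.
pose F := filter_from [set: nat] (fun n => @cylinder T n x).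
have FF : Filter F.
  apply: filter_from_filter; first by exists 0%N.
  move=> m n _ _; exists (maxn m n) => // x' cx; split => i le; apply: cx.
    exact: leq_trans (leq_maxl _ _).
  exact: leq_trans (leq_maxr _ _).
move=> nU.
suff : F U by case=> n _; exists n.
have := @cvg_prod_topology nat (fun=> discrete_topology T) F x FF _ U nU; apply.
move=> t V /principal_filterP Vx; exists t => // x' cx.
by rewrite /= /proj cx.
Qed.

Lemma open_finitary n (C : set (seqspace T)) : finitary n C -> open C.
Proof.
move=> fC; rewrite openE => x Cx; apply: filterS (nbhs_cylinder n x).
by move=> x' cx; apply: fC Cx => i /cx ->.
Qed.

(** An open set is the countable union over [n] of the finitary sets of points whose [n]-cylinder it
    contains. *)
Lemma measurable_finitary : @measurable _ (seqspace T) = <<s @is_finitary T >>.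
Proof.
rewrite /measurable/=; apply/seteqP; split.
  apply: smallest_sub; first exact: smallest_sigma_algebra.
  move=> U oU; pose V n := [set x | cylinder n x `<=` U].
  have -> : U = \bigcup_n V n.
    apply/seteqP; split => [x Ux|x [n _]]; last by apply.
    have [n nU] := nbhs_sub_cylinder (open_nbhs_nbhs (conj oU Ux)).
    by exists n.
  apply: sigma_algebra_bigcup => n; apply: sub_sigma_algebra; exists n.
  move=> x x' xx' Vx z cz; apply: Vx => i ni; rewrite xx'//; exact: cz.
apply: smallest_sub; first exact: smallest_sigma_algebra.
by move=> C [n fC]; apply: sub_sigma_algebra; exact: open_finitary fC.
Qed.

Lemma finitary_measurable n (C : set (seqspace T)) : finitary n C -> measurable C.
Proof.
by move=> fC; rewrite measurable_finitary; apply: sub_sigma_algebra; exists n.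
Qed.

Lemma is_finitary_measurable (C : set (seqspace T)) :
  is_finitary C -> measurable C.
Proof. by case=> n; exact: finitary_measurable. Qed.

(** Dynkin's theorem for the pi-system of finitary sets; it reduces measurability claims about Borel
    sets to finitary ones. *)
Lemma finitary_induction (H : set (set (seqspace T))) :
  (forall C, is_finitary C -> H C) ->
  (forall C, measurable C -> H C -> H (~` C)) ->
  (forall F : (set (seqspace T))^nat, (forall n, measurable (F n)) ->
    trivIset setT F -> (forall n, H (F n)) -> H (\bigcup_n F n)) ->
  forall C, measurable C -> H C.
Proof.
move=> Hf HC HU C; rewrite measurable_finitary.
apply: dynkin_induction => //; first exact: measurable_finitary.
  exact: is_finitary_setI.
exact/Hf/is_finitary_setT.
Qed.

(** Compactness from König's lemma: a point all of whose cylinders meet the uncovered part of [C]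
    would lie in [C], hence in some [F i], which contains a whole cylinder around it. *)
Lemma finitary_compact (F : nat -> set (seqspace T)) (C : set (seqspace T)) :
  is_finitary C -> (forall n, is_finitary (F n)) -> C `<=` \bigcup_n F n ->
  exists N, C `<=` \bigcup_(i < N) F i.
Proof.
move=> [k fC] fF CF; apply: contrapT => /forallNP nN.
(* Speaking of the whole cylinder makes [D n] depend on coordinates up to [n] only, although [F i]
   may look further. *)
pose D n := [set x | ~ (cylinder n x `<=` ~` C `|` \bigcup_(i < n) F i)].
have [||n|z Dz] := @konig T D.
- move=> n x; apply: contra_not => sub x' cx.
  have [|nC|[i /= lt Fi]] := sub x'; [|by left|].
    by move=> i /leqW; exact: cx.
  by right; exists i => //=; exact: ltnW.
- move=> n x x' xx'; apply: contra_not => sub z cz; apply: sub => i ni.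
  by rewrite -xx'//; exact: cz.
- have /existsNP[x /not_implyP[Cx nx]] := nN n.
  by exists x => /(_ x); case => //.
have [Cz|nCz] := pselect (C z); last first.
  apply: (Dz k) => x cx; left; apply: contra_not nCz.
  by apply: fC => i /cx.
have [i _ Fi] := CF _ Cz; have [n fi] := fF i.
apply: (Dz (maxn n i.+1)) => x cx; right; exists i => /=.
  exact: leq_maxr.
by apply: fi Fi => j jn; rewrite cx// (leq_trans jn)// leq_maxl.
Qed.

Definition first_word n (x : seqspace T) : {ffun 'I_n.+1 -> T} :=
  [ffun i : 'I_n.+1 => x i].

(** Past [n], [inord] falls back on index 0; only the coordinates up to [n] matter. *)
Definition pad n (w : {ffun 'I_n.+1 -> T}) : seqspace T := fun i => w (inord i).

Lemma preimage_first_word n (w : {ffun 'I_n.+1 -> T}) :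
  first_word n @^-1` [set w] = cylinder n (pad w).
Proof.
apply/seteqP; split => x /=.
  by move=> <- i ni; rewrite /pad ffunE inordK.
move=> cx; apply/ffunP => i; rewrite ffunE cx; last by rewrite -ltnS.
by rewrite /pad inord_val.
Qed.

Lemma cylinder_pad n (x : seqspace T) : cylinder n (pad (first_word n x)) x.
Proof. by rewrite -preimage_first_word. Qed.

Lemma measurable_first_word n w : measurable (first_word n @^-1` [set w]).
Proof.
by rewrite preimage_first_word; apply: finitary_measurable; exact: finitary_cylinder.
Qed.

Lemma measurable_SFT (M : rel T) : measurable (SFT M).
Proof.
have -> : SFT M = \bigcap_n [set x | M (x n) (x n.+1)].
  by apply/seteqP; split => [x Mx n _|x Mx n]; [exact: Mx|exact: (Mx n I)].
apply: bigcapT_measurable => n; apply: (@finitary_measurable n.+1).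
by move=> x x' xx' /=; rewrite !xx'.
Qed.

End cylinders.

(** * Extension of measures from finitary sets *)

Section finitary_extension.
Variables (T : alphabetType) (R : realType).
Implicit Types C D : set (seqspace T).

(* The algebra of finitary sets, as a structure separate from the Borel sets. *)
Definition finitary_alg : Type := seqspace T.

Fact finitary_display : measure_display.
Proof. exact: default_measure_display. Qed.

HB.instance Definition _ := Pointed.on finitary_alg.
HB.instance Definition _ := @isAlgebraOfSets.Build finitary_display finitary_alg
  (@is_finitary T) (@is_finitary_set0 T) (@is_finitary_setU T)
  (@is_finitary_setC T).

Variable l : set (seqspace T) -> R.
Hypothesis l_ge0 : forall C, 0 <= l C.
Hypothesis lD : forall C D, is_finitary C -> is_finitary D ->
  C `&` D = set0 -> l (C `|` D) = l C + l D.
Hypothesis lT : l setT = 1.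

Let premeasure (C : set finitary_alg) : \bar R := (l C)%:E.

Let l0 : l set0 = 0.
Proof.
have := lD (@is_finitary_setT T) (@is_finitary_set0 T) (setI0 _).
by rewrite setU0 lT => e; lra.
Qed.

Let premeasure0 : premeasure set0 = 0%E. Proof. by rewrite /premeasure l0. Qed.

Let premeasure_ge0 C : (0 <= premeasure C)%E.
Proof. by rewrite lee_fin. Qed.

Let premeasure_sum (F : nat -> set (seqspace T)) n :
  (forall i, is_finitary (F i)) -> trivIset setT F ->
  is_finitary (\big[setU/set0]_(i < n) F i) /\
  (\sum_(0 <= i < n) premeasure (F i) =
   premeasure (\big[setU/set0]_(i < n) F i))%E.
Proof.
move=> fF tF; elim: n => [|n [fU IH]].
  by rewrite big_nil big_ord0 premeasure0; split => //; exact: is_finitary_set0.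
rewrite big_nat_recr//= big_ord_recr /= IH; split; first exact: is_finitary_setU.
rewrite /premeasure lD// -subset0 => x [].
rewrite -bigcup_mkord => -[i /= lt Fi] Fn.
by have := tF i n I I (ex_intro _ x (conj Fi Fn)) => e; rewrite e ltnn in lt.
Qed.

(** By compactness finitely many of the sets already cover a finitary union, so the partial sums are
    eventually constant. *)
Let premeasure_sigma_additive : semi_sigma_additive premeasure.
Proof.
move=> F mF tF mU; have [N UN] := finitary_compact mU mF (@subset_refl _ _).
apply: cvg_near_cst; exists N => // n /= Nn.
rewrite (premeasure_sum n mF tF).2; congr premeasure.
rewrite -bigcup_mkord; apply/seteqP; split => x; first by case=> i _ Fi; exists i.
by move=> /UN[i /= lt Fi]; exists i => //=; exact: leq_trans Nn.
Qed.

HB.instance Definition _ := isMeasure.Build _ _ R premeasure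
  premeasure0 premeasure_ge0 premeasure_sigma_additive.

(** The Carathéodory extension is built over [finitary_alg]; its sigma-algebra is the Borel one by
    [measurable_finitary], so it can be read on [seqspace T]. *)
Let ext : set (seqspace T) -> \bar R := @measure_extension _ finitary_alg R premeasure.

Let sub_ext C : measurable C -> <<s @measurable _ finitary_alg >> C.
Proof. by rewrite measurable_finitary. Qed.

Let ext0 : ext set0 = 0%E. Proof. exact: measure0. Qed.

Let ext_ge0 C : (0 <= ext C)%E. Proof. exact: measure_ge0. Qed.

Let ext_sigma_additive : semi_sigma_additive ext.
Proof.
move=> F mF tF mU.
apply: (@measure_semi_sigma_additive _ _ _
  (@measure_extension _ finitary_alg R premeasure)) => //.
  by move=> i; exact: sub_ext.
exact: sub_ext.
Qed.

Let extE C : is_finitary C -> ext C = (l C)%:E.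
Proof. by move=> fC; rewrite /ext /measure_extension measurable_mu_extE. Qed.

HB.instance Definition _ := isMeasure.Build _ (seqspace T) R ext
  ext0 ext_ge0 ext_sigma_additive.

Let extT : ext setT = 1%E.
Proof. by rewrite extE ?lT//; exact: is_finitary_setT. Qed.

HB.instance Definition _ := Measure_isProbability.Build _ _ R ext extT.

Lemma finitary_extension : exists m : probability (seqspace T) R,
  forall C, is_finitary C -> m C = (l C)%:E.
Proof. by exists ext; exact: extE. Qed.

End finitary_extension.

(** * Contraction by matrices with rectangular support *)

Section contraction.
Variables (R : realFieldType) (A : finType).
Variables (S : pred A) (Q : A -> A -> R) (d : R).
Hypothesis d01 : 0 <= d <= 1.
Hypothesis Q01 : forall c e, 0 <= Q c e <= 1.
Hypothesis Qd : forall c e, 0 < Q c e -> d <= Q c e.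
Hypothesis Qrect : forall c c' e e', S c -> S c' ->
  0 < Q c e -> 0 < Q c' e' -> 0 < Q c e'.

(** By [Qrect] all live rows have the same positive columns; the other rows add nothing when the
    vector is supported on [S]. *)
Let alive c := S c && [exists e, 0 < Q c e].

(** In a column reached from [S], live entries lie between [d] and 1, so the product with [W] is at
    most the live mass of [W] and the product with [X] at least [d] times that of [X]. In any other
    column both vanish. A comparison of masses thus becomes entrywise. *)
Lemma vecmul_lower_bound (X W : A -> R) t :
  (forall c, 0 <= X c) -> (forall c, 0 <= W c) ->
  (forall c, ~~ S c -> W c = 0) -> (forall c, ~~ S c -> X c = 0) -> 0 <= t ->
  t * \sum_(c | alive c) W c <= \sum_(c | alive c) X c ->
  forall e, d * t * (\sum_c W c * Q c e) <= \sum_c X c * Q c e.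
Proof.
move=> X0 W0 WS XS t0 tWX e; have /andP[d0 d1] := d01.
have dead (Z : A -> R) : (forall c, ~~ S c -> Z c = 0) ->
    \sum_c Z c * Q c e = \sum_(c | alive c) Z c * Q c e.
  move=> ZS; rewrite [LHS](bigID alive)/= [X in _ + X]big1 ?addr0// => c.
  have /andP[Q0 _] := Q01 c e.
  rewrite /alive negb_and => /orP[/ZS ->|/existsPn/(_ e)]; first by rewrite mul0r.
  by rewrite -leNgt => Qle; have -> : Q c e = 0 by [lra]; rewrite mulr0.
rewrite !dead//.
have [/existsP[c0 /andP[Sc0 Q0]]|/existsPn none] :=
    boolP [exists c, S c && (0 < Q c e)]; last first.
  have zero (Z : A -> R) : \sum_(c | alive c) Z c * Q c e = 0.
    rewrite big1// => c /andP[Sc _]; have := none c; rewrite Sc/= -leNgt => Qle.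
    have /andP[Q0 _] := Q01 c e.
    by have -> : Q c e = 0 by [lra]; rewrite mulr0.
  by rewrite !zero mulr0.
apply: (@le_trans _ _ (d * \sum_(c | alive c) X c)).
  rewrite -mulrA ler_wpM2l//; apply: le_trans tWX; rewrite ler_wpM2l//.
  by apply: ler_sum => c _; rewrite ler_piMr//; have /andP[] := Q01 c e.
rewrite mulr_sumr; apply: ler_sum => c /andP[Sc /existsP[e' Qe']].
by rewrite mulrC ler_wpM2l//; apply: Qd; exact: Qrect Qe' Q0.
Qed.

(** The gaps [F - a W] and [b W - F] add up to [(b - a) W], so one of them holds at least half of
    the live mass. The previous lemma spreads that gap over all columns and moves the corresponding
    endpoint by [d (b - a) / 2], whence the factor [1 - d / 2]. *)
Lemma vecmul_contraction (F W : A -> R) a b :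
  (forall c, 0 <= W c) -> (forall c, ~~ S c -> W c = 0) -> a <= b ->
  (forall c, a * W c <= F c <= b * W c) ->
  exists a' b', [/\ a <= a', a' <= b', b' <= b, b' - a' = (1 - d / 2) * (b - a) &
    forall e, a' * (\sum_c W c * Q c e) <= \sum_c F c * Q c e
      <= b' * (\sum_c W c * Q c e)].
Proof.
move=> W0 WS ab FW; have /andP[d0 d1] := d01.
have FS c : ~~ S c -> F c = 0.
  by move=> /WS Wc; have := FW c; rewrite Wc !mulr0 => ?; lra.
have weaken a' b' : (forall c, a' * W c <= F c <= b' * W c) -> forall e,
    a' * (\sum_c W c * Q c e) <= \sum_c F c * Q c e
      <= b' * (\sum_c W c * Q c e).
  move=> FW' e; rewrite !mulr_sumr.
  apply/andP; split; apply: ler_sum => c _; rewrite mulrA ler_wpM2r//;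
  by have /andP[] := Q01 c e; have /andP[] := FW' c.
have := weaken _ _ FW => FWQ.
pose X c := F c - a * W c; pose Y c := b * W c - F c.
have X0 c : 0 <= X c by rewrite subr_ge0; have /andP[] := FW c.
have Y0 c : 0 <= Y c by rewrite subr_ge0; have /andP[] := FW c.
have XS c : ~~ S c -> X c = 0 by move=> nS; rewrite /X FS ?WS//; ring.
have YS c : ~~ S c -> Y c = 0 by move=> nS; rewrite /Y FS ?WS//; ring.
pose V := \sum_(c | alive c) W c.
have XY : \sum_(c | alive c) X c + \sum_(c | alive c) Y c = (b - a) * V.
  by rewrite -big_split mulr_sumr; apply: eq_bigr => c _; rewrite /= /X /Y; ring.
have t0 : 0 <= (b - a) / 2 by lra.
have gap : 0 <= d * ((b - a) / 2) <= b - a.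
  rewrite mulr_ge0//=; apply: (@le_trans _ _ ((b - a) / 2)); last lra.
  by rewrite ler_piMl.
have [le|lt] := leP ((b - a) / 2 * V) (\sum_(c | alive c) X c).
- have H := vecmul_lower_bound X0 W0 WS XS t0 le.
  exists (a + d * ((b - a) / 2)), b; split; [lra|lra|lra|by field|].
  move=> e; have /andP[_ ->] := FWQ e; rewrite andbT; have := H e.
  rewrite /X; under [X in _ <= X -> _]eq_bigr do rewrite mulrBl -mulrA.
  by rewrite sumrB -mulr_sumr; lra.
- have le : (b - a) / 2 * V <= \sum_(c | alive c) Y c by lra.
  have H := vecmul_lower_bound Y0 W0 WS YS t0 le.
  exists a, (b - d * ((b - a) / 2)); split; [lra|lra|lra|by field|].
  move=> e; have /andP[-> _] := FWQ e; rewrite /=; have := H e.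
  rewrite /Y; under [X in _ <= X -> _]eq_bigr do rewrite mulrBl -mulrA.
  by rewrite sumrB -mulr_sumr; lra.
Qed.

End contraction.

(** * Paths lifting a word, and rectangle times *)

Section lifts.
Variables (A : finType) (B : eqType) (M : rel A) (p : A -> B).

Definition lift_path (y : nat -> B) n (u : nat -> A) : Prop :=
  (forall i, (i < n)%N -> M (u i) (u i.+1)) /\
  (forall i, (i <= n)%N -> p (u i) = y i).

(** Starts that survive [N] steps and ends reached after [N] steps combine freely; this is the
    rectangular support of an [N]-block product, for all base words at once. *)
Definition rectangle_time N : Prop :=
  forall y x x', lift_path y N x -> lift_path y N x' ->
    exists u, [/\ lift_path y N u, u 0%N = x 0%N & u N = x' N].

Lemma lift_path_le y m n u : (m <= n)%N -> lift_path y n u -> lift_path y m u.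
Proof.
move=> mn [uM up]; split=> i im; first by apply: uM; exact: leq_trans mn.
by apply: up; exact: leq_trans mn.
Qed.

Lemma lift_path_splice y n m u v : (n <= m)%N -> u n = v n ->
  lift_path y n u -> lift_path y m v ->
  lift_path y m (fun i => if (i <= n)%N then u i else v i).
Proof.
move=> nm uv [uM up] [vM vp]; split => i im; last first.
  by case: leqP => [|_]; [exact: up|exact: vp].
case: (ltngtP i n) => [lt|gt|e]; [exact: uM|exact: vM|].
by rewrite e uv; apply: vM; rewrite -e.
Qed.

(* König's lemma on pairs of paths: if every time failed, a limiting pair of
   points of one fibre could never be joined, against fibre mixing. *)
Lemma fibre_mixing_rectangle_time :
  fibre_mixing (SFT M) p -> exists N, rectangle_time N.
Proof.
move=> mix; apply: contrapT => /forallNP noN.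
pose x1 (z : nat -> A * A) i := (z i).1; pose x2 (z : nat -> A * A) i := (z i).2.
(* The base word is read off the first path. Asking for no meeting at any time [j <= n], not only at
   [n], makes [D] decreasing. *)
pose D n := [set z : nat -> A * A | [/\ lift_path (p \o x1 z) n (x1 z),
  lift_path (p \o x1 z) n (x2 z) & forall j, (j <= n)%N -> forall u,
    lift_path (p \o x1 z) j u -> u 0%N = x1 z 0%N -> u j <> x2 z j]].
have [||n|z Dz] := @konig _ D.
- move=> n z [l1 l2 no]; split; [exact: lift_path_le l1|exact: lift_path_le l2|].
  by move=> j /leqW; exact: no.
- move=> n z z' zz' [l1 l2 no].
  have E j u : (j <= n)%N -> lift_path (p \o x1 z) j u <-> lift_path (p \o x1 z') j u.
    by move=> jn; split=> -[uM up]; split => // i ij; rewrite up//= /x1 zz'//;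
      exact: leq_trans jn.
  have E1 i : (i <= n)%N -> x1 z' i = x1 z i by move=> /zz'; rewrite /x1 => ->.
  have E2 i : (i <= n)%N -> x2 z' i = x2 z i by move=> /zz'; rewrite /x2 => ->.
  split.
  + apply/E => //; case: l1 => uM up; split => i le; last by rewrite E1//; exact: up.
    by rewrite !E1//; [exact: uM|exact: ltnW].
  + apply/E => //; case: l2 => uM up; split => i le; last by rewrite E2//; exact: up.
    by rewrite !E2//; [exact: uM|exact: ltnW].
  + by move=> j jn u /(E _ _ jn) lu; rewrite E1// E2//; exact: no.
- have /existsNP[y /existsNP[x /existsNP[x']]] := noN n.
  move=> /not_implyP[lx /not_implyP[lx' /forallNP no]].
  have E j u : (j <= n)%N -> lift_path (p \o x) j u <-> lift_path y j u.
    move=> jn; split=> -[uM up]; split => // i ij; rewrite up//=.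
      by case: lx => _; apply; exact: leq_trans jn.
    by case: lx => _ ->//; exact: leq_trans jn.
  exists (fun i => (x i, x' i)); split; [exact/E|exact/E|].
  move=> j jn u /(E _ _ jn) lu u0 ux'.
  (* A path meeting [x'] at time [j] can follow it up to [n], so failure at [n] forces failure at
     every earlier time. *)
  apply: (no (fun i => if (i <= j)%N then u i else x' i)); split => //.
    exact: lift_path_splice.
  by case: leqP => // nj; have -> : n = j by apply/eqP; rewrite eqn_leq nj.
have O1 : SFT M (x1 z) by move=> n; have [[l _] _ _] := Dz n.+1; exact: l.
have O2 : SFT M (x2 z) by move=> n; have [_ [l _] _] := Dz n.+1; exact: l.
have f2 : fibre (SFT M) p (p \o x1 z) (x2 z).
  split => //; apply/funext => n; have [_ [_ l] _] := Dz n; exact: l.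
(* Mixing is used with [n = 0]: only the initial letter is kept, and the forbidden meeting occurs at
   time [m]. *)
have [|w [m [fw h0 hm]]] := mix _ _ (x1 z) (x2 z) (conj O1 erefl) f2 0%N.
  by exists (x1 z).
have [Ow ew] := fw; have [_ _ no] := Dz m; apply: (no m (leqnn m) w); last exact: hm.
  by split => [i _|i _]; [exact: Ow|exact: (congr1 (fun g => g i) ew)].
exact: h0.
Qed.

End lifts.

Lemma sumr_gt0_ex (R : numDomainType) (I : finType) (F : I -> R) :
  (forall i, 0 <= F i) -> 0 < \sum_i F i -> exists i, 0 < F i.
Proof.
move=> F0 S0; apply: contrapT => /forallNP none; move: S0.
rewrite big1 ?ltxx// => i _; apply/eqP; rewrite eq_le F0 andbT.
by have /negP := none i; rewrite lt0r F0 andbT negbK => /eqP ->.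
Qed.

Lemma sumr_gt0 (R : numDomainType) (I : finType) (F : I -> R) i :
  (forall i, 0 <= F i) -> 0 < F i -> 0 < \sum_i F i.
Proof.
move=> F0 Fi; rewrite (bigD1 i)//=; apply: ltr_wpDr => //.
by apply: sumr_ge0 => j _.
Qed.

(** * Transfer matrices over a base sequence *)

Section transfer.
Variables (R : realType) (A : alphabetType) (B : eqType) (M : rel A) (p : A -> B).
Variable P : A -> A -> R.
Hypothesis stochP : stochastic P.
Hypothesis compP : compatible P M.
Implicit Types (F W : A -> R) (y : nat -> B).

(** One step of the unnormalised filter of a hidden Markov chain: move by [P], then keep the letters
    over the observation [b]. *)
Definition forward b F e := if p e == b then \sum_c F c * P c e else 0.

(** The observation [y 0] is not imposed here; it enters through the support of the initial
    vector. *)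
Fixpoint transfer y j F :=
  if j is k.+1 then forward (y j) (transfer y k F) else F.

Definition transfer_mx y j c := transfer y j (fun e => (c == e)%:R).

Lemma transferE y j F e : transfer y j F e = \sum_c F c * transfer_mx y j c e.
Proof.
elim: j e => [|j IH] e.
  rewrite /transfer_mx/= (bigD1 e)//= eqxx mulr1 big1 ?addr0// => c /negPf ->.
  by rewrite mulr0.
rewrite /transfer_mx/= /forward; case: ifP => _; last first.
  by rewrite big1// => c _; rewrite mulr0.
under [LHS]eq_bigr => c _ do rewrite IH mulr_suml.
rewrite exchange_big/=; apply: eq_bigr => c _; rewrite mulr_sumr.
by apply: eq_bigr => e' _; rewrite mulrA.
Qed.

Let P_ge0 a c : 0 <= P a c. Proof. exact: stochP.1. Qed.

Lemma forward_ge0 b F : (forall c, 0 <= F c) -> forall e, 0 <= forward b F e.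
Proof.
move=> F0 e; rewrite /forward; case: ifP => // _.
by apply: sumr_ge0 => c _; exact: mulr_ge0.
Qed.

Lemma transfer_mx_ge0 y j c e : 0 <= transfer_mx y j c e.
Proof.
rewrite /transfer_mx; elim: j e => [|j IH] e; first exact: ler0n.
exact: forward_ge0.
Qed.

Lemma transfer_mx_le1 y j c e : transfer_mx y j c e <= 1.
Proof.
(* Row sums, unlike single entries, propagate: dropping columns of a stochastic matrix leaves it
   substochastic. *)
suff H : \sum_e transfer_mx y j c e <= 1.
  apply: le_trans H; rewrite (bigD1 e)//= lerDl.
  by apply: sumr_ge0 => ? _; exact: transfer_mx_ge0.
elim: j {e} => [|j IH].
  rewrite /transfer_mx/= (bigD1 c)//= eqxx big1 ?addr0// => e.
  by rewrite eq_sym => /negPf ->.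
apply: le_trans IH; rewrite {1}/transfer_mx/=.
apply: (@le_trans _ _ (\sum_e \sum_a transfer_mx y j c a * P a e)).
  apply: ler_sum => e _; rewrite /forward; case: ifP => // _.
  by apply: sumr_ge0 => a _; rewrite mulr_ge0// transfer_mx_ge0.
rewrite exchange_big/=; apply: ler_sum => a _.
by rewrite -mulr_sumr stochP.2 mulr1.
Qed.

Lemma transfer_mx_gt0S y j c e : 0 < transfer_mx y j.+1 c e ->
  p e = y j.+1 /\ exists a, 0 < transfer_mx y j c a /\ 0 < P a e.
Proof.
rewrite {1}/transfer_mx/= /forward; case: eqP => [pe|_]; last by rewrite ltxx.
move=> /sumr_gt0_ex[a|a Ha]; first by rewrite mulr_ge0// transfer_mx_ge0.
split=> //; exists a; apply/andP.
have := transfer_mx_ge0 y j c a; have := P_ge0 a e.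
rewrite le0r => /orP[/eqP P0|->]; first by rewrite P0 mulr0 ltxx in Ha.
by rewrite le0r andbT => /orP[/eqP Q0|//]; rewrite -/(transfer_mx y j c a) Q0 mul0r ltxx in Ha.
Qed.

(** A positive entry contains the weight of at least one path, a product of [j] positive entries of
    [P]. *)
Lemma transfer_mx_lower_bound pm : 0 <= pm ->
  (forall a c, 0 < P a c -> pm <= P a c) ->
  forall y j c e, 0 < transfer_mx y j c e -> pm ^+ j <= transfer_mx y j c e.
Proof.
move=> pm0 Ppm y j c; elim: j => [|j IH] e.
  by rewrite /transfer_mx/=; case: eqP => _; rewrite ?ltxx.
move=> /[dup] /transfer_mx_gt0S[pe [a [Qa Pa]]] _.
rewrite {1}/transfer_mx/= /forward pe eqxx (bigD1 a)//= exprSr.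
apply: (@le_trans _ _ (transfer_mx y j c a * P a e)).
  by apply: ler_pM; rewrite ?exprn_ge0//; [exact: IH|exact: Ppm].
by rewrite lerDl sumr_ge0// => i _; rewrite mulr_ge0// transfer_mx_ge0.
Qed.

Lemma transfer_mx_path y j c e : p c = y 0%N -> 0 < transfer_mx y j c e ->
  exists u, [/\ lift_path M p y j u, u 0%N = c & u j = e].
Proof.
move=> pc; elim: j e => [|j IH] e.
  rewrite /transfer_mx/=; case: eqP => [<- _|_]; last by rewrite ltxx.
  by exists (fun=> c); split => //; split => // i; rewrite leqn0 => /eqP ->.
move=> /transfer_mx_gt0S[pe [a [/IH[u [[uM up] u0 uj]] /compP Mae]]].
exists (fun i => if (i <= j)%N then u i else e); split; rewrite ?ltnn//.
split=> i; last first.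
  case: (leqP i j) => [ij _|ji ij]; first exact: up.
  by have -> : i = j.+1 by [apply/eqP; rewrite eqn_leq ij].
by rewrite ltnS; case: (ltngtP i j) => // [lt _|-> _]; [exact: uM|rewrite uj].
Qed.

Lemma path_transfer_mx y j u : lift_path M p y j u ->
  0 < transfer_mx y j (u 0%N) (u j).
Proof.
elim: j => [|j IH] lu; first by rewrite /transfer_mx/= eqxx.
have lj := IH (lift_path_le (leqnSn j) lu); case: lu => uM up.
rewrite /transfer_mx/= /forward up// eqxx; apply: (@sumr_gt0 _ _ _ (u j)).
  by move=> a; rewrite mulr_ge0// transfer_mx_ge0.
by rewrite mulr_gt0//; apply/compP/uM.
Qed.

Lemma positive_entry_bound : exists2 pm, 0 < pm <= 1 &
  forall a c, 0 < P a c -> pm <= P a c.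
Proof.
(* With zero entries replaced by 1, the product over all pairs is positive and, each factor being at
   most 1, lies below every positive entry. *)
pose f (ac : A * A) := if 0 < P ac.1 ac.2 then P ac.1 ac.2 else 1.
have f01 ac : 0 < f ac <= 1.
  rewrite /f; case: ifP => [->|_]; last by rewrite ltr01 lexx.
  rewrite /= -(stochP.2 ac.1) (bigD1 ac.2)//= lerDl.
  by apply: sumr_ge0 => c _.
have f0 ac : 0 <= f ac by have /andP[/ltW] := f01 ac.
exists (\prod_ac f ac) => [|a c Pac].
  rewrite prodr_gt0 => [|ac _]; last by have /andP[] := f01 ac.
  by rewrite /= prodr_ile1// => ac _; rewrite f0; have /andP[] := f01 ac.
rewrite (bigD1 (a, c))//= {1}/f/= Pac ler_piMr//.
by rewrite prodr_ile1// => ac _; rewrite f0; have /andP[] := f01 ac.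
Qed.

Variable N : nat.
Hypothesis rectN : rectangle_time M p N.

Lemma transfer_mx_rect y c c' e e' : p c = y 0%N -> p c' = y 0%N ->
  0 < transfer_mx y N c e -> 0 < transfer_mx y N c' e' ->
  0 < transfer_mx y N c e'.
Proof.
move=> pc pc' /(transfer_mx_path pc)[u [lu <- _]].
move=> /(transfer_mx_path pc')[u' [lu' _ <-]].
have [v [lv <- <-]] := rectN lu lu'; exact: path_transfer_mx.
Qed.

Lemma transfer_shift y (F : nat -> A -> R) k n j :
  (forall m, (k <= m)%N -> F m.+1 = forward (y m.+1) (F m)) -> (k <= n)%N ->
  F (n + j)%N = transfer (fun i => y (n + i)%N) j (F n).
Proof.
move=> Fk kn; elim: j => [|j IH]; first by rewrite addn0.
by rewrite addnS Fk ?(leq_trans kn) ?leq_addr//= IH addnS.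
Qed.

Lemma forward_support y (F : nat -> A -> R) k n c :
  (forall m, (k <= m)%N -> F m.+1 = forward (y m.+1) (F m)) ->
  (forall c, p c != y k -> F k c = 0) -> (k <= n)%N -> p c != y n -> F n c = 0.
Proof.
move=> FS Fk; rewrite leq_eqVlt => /orP[/eqP <-|]; first exact: Fk.
by case: n => // n; rewrite ltnS => kn /negPf pc; rewrite FS// /forward pc.
Qed.

Lemma forward_seq_ge0 y (F : nat -> A -> R) k n c :
  (forall m, (k <= m)%N -> F m.+1 = forward (y m.+1) (F m)) ->
  (forall c, 0 <= F k c) -> (k <= n)%N -> 0 <= F n c.
Proof.
move=> FS Fk /subnKC <-; elim: (n - k)%N c => [|j IH] c; first by rewrite addn0.
by rewrite addnS FS ?leq_addr//; exact: forward_ge0.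
Qed.

Lemma forward_between b a1 a2 F W :
  (forall c, a1 * W c <= F c <= a2 * W c) ->
  forall e, a1 * forward b W e <= forward b F e <= a2 * forward b W e.
Proof.
move=> FW e; rewrite /forward; case: ifP => _; last by rewrite !mulr0 lexx.
rewrite !mulr_sumr; apply/andP; split; apply: ler_sum => c _;
by rewrite mulrA ler_wpM2r//; have /andP[] := FW c.
Qed.

(** A bracket [a W <= F <= b W] survives every step, and each block of [N] steps shrinks it by
    [1 - pm ^+ N / 2]. The rate is chosen before [y], [k], [F] and [W], which gives uniformity
    later. The start [k] leaves room for the coordinates read by a cylinder. *)
Lemma forward_contraction : exists2 r : R, 0 <= r < 1 &
  forall y k (F W : nat -> A -> R),
    (forall m, (k <= m)%N -> F m.+1 = forward (y m.+1) (F m)) ->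
    (forall m, (k <= m)%N -> W m.+1 = forward (y m.+1) (W m)) ->
    (forall c, p c != y k -> W k c = 0) -> (forall c, 0 <= F k c <= W k c) ->
  forall j, exists a b, [/\ 0 <= a, a <= b, b <= 1, b - a <= r ^+ j &
    forall n c, (k + j * N <= n)%N -> a * W n c <= F n c <= b * W n c].
Proof.
have [pm /andP[pm0 pm1] Ppm] := positive_entry_bound.
have d0 : 0 < pm ^+ N by exact: exprn_gt0.
have d1 : pm ^+ N <= 1 by rewrite exprn_ile1// ltW.
exists (1 - pm ^+ N / 2); first lra.
move=> y k F W FS WS Wk FWk; elim=> [|j [a [b [a0 ab b1 bar FW]]]].
  exists 0, 1; split => //; first by rewrite expr0 subr0.
  move=> n c; rewrite mul0n addn0 => /subnKC <-.
  elim: (n - k)%N c => [|i IH] c; first by rewrite addn0 mul0r mul1r.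
  by rewrite addnS FS ?WS ?leq_addr//; exact: forward_between.
(* The next block starts at [n0]; its live rows are among the letters over [y n0]. *)
pose n0 := (k + j * N)%N; have kn0 : (k <= n0)%N by rewrite leq_addr.
pose y0 i := y (n0 + i)%N.
have W0 c : 0 <= W n0 c.
  apply: forward_seq_ge0 WS _ kn0 => e; have /andP[? ?] := FWk e; lra.
have Ws c : ~~ [pred c | p c == y0 0%N] c -> W n0 c = 0.
  by rewrite /= /y0 addn0; exact: forward_support WS Wk kn0.
have [a' [b' [aa' ab' bb' ba' FW']]] := @vecmul_contraction R A
  [pred c | p c == y0 0%N] (transfer_mx y0 N) (pm ^+ N)
  (introT andP (conj (ltW d0) d1))
  (fun c e => introT andP (conj (transfer_mx_ge0 y0 N c e) (transfer_mx_le1 y0 N c e)))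
  (fun c e => @transfer_mx_lower_bound pm (ltW pm0) Ppm y0 N c e)
  (fun c c' e e' pc pc' => transfer_mx_rect (eqP pc) (eqP pc'))
  (F n0) (W n0) a b W0 Ws ab (fun c => FW n0 c (leqnn _)).
exists a', b'; split => //; [lra|lra| |].
  by rewrite ba' exprS ler_wpM2l//; lra.
move=> n c; rewrite mulSn addnC -addnA [(j * N + k)%N]addnC -/n0 addnC => /subnKC <-.
elim: (n - _)%N c => [|i IH] c.
  by rewrite addn0 (transfer_shift N FS kn0) (transfer_shift N WS kn0) !transferE.
rewrite addnS FS ?WS; [exact: forward_between| |];
by rewrite -addnA (leq_trans kn0) ?leq_addr.
Qed.

(** The contraction bracket may keep lower end 0, so positivity needs its own estimate. Mass [t] on
    a letter that survives [N] steps puts at least [pm ^+ N * t] on every reachable letter, where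
    [W] has at most its initial mass, itself at most 1; the bound then persists. *)
Lemma forward_lower_bound : exists2 r : R, 0 < r &
  forall y (W : nat -> A -> R) u t,
    (forall m, W m.+1 = forward (y m.+1) (W m)) ->
    (forall c, p c != y 0%N -> W 0%N c = 0) ->
    (forall c, 0 <= W 0%N c) -> \sum_c W 0%N c <= 1 ->
    lift_path M p y N u -> 0 <= t ->
  forall F : nat -> A -> R, (forall m, F m.+1 = forward (y m.+1) (F m)) ->
    (F 0%N = fun c => if c == u 0%N then t else 0) ->
    forall n c, (N <= n)%N -> r * t * W n c <= F n c.
Proof.
have [pm /andP[pm0 pm1] Ppm] := positive_entry_bound.
have d0 : 0 < pm ^+ N by exact: exprn_gt0.
have d1 : pm ^+ N <= 1 by rewrite exprn_ile1// ltW.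
exists (pm ^+ N) => //.
move=> y W u t WS Ws W0 W1 lu t0 F FS F0.
have WSk m : (0 <= m)%N -> W m.+1 = forward (y m.+1) (W m) by [].
have FSk m : (0 <= m)%N -> F m.+1 = forward (y m.+1) (F m) by [].
have pu : p (u 0%N) = y 0%N by case: lu => _; apply.
have H := @vecmul_lower_bound R A [pred c | p c == y 0%N] (transfer_mx y N) (pm ^+ N)
  (introT andP (conj (ltW d0) d1))
  (fun c e => introT andP (conj (transfer_mx_ge0 y N c e) (transfer_mx_le1 y N c e)))
  (fun c e => @transfer_mx_lower_bound pm (ltW pm0) Ppm y N c e)
  (fun c c' e e' pc pc' => transfer_mx_rect (eqP pc) (eqP pc'))
  (F 0%N) (W 0%N) t _ W0 Ws _ t0 _.
move=> n c /subnKC <-; elim: (n - N)%N c => [|i IH] c.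
  have E G : (forall m, (0 <= m)%N -> G m.+1 = forward (y m.+1) (G m)) ->
      G N c = \sum_a G 0%N a * transfer_mx y N a c.
    by move=> GS; rewrite (transfer_shift N GS (leqnn 0)) transferE.
  rewrite addn0 !E//; apply: H.
  + by move=> a; rewrite F0; case: eqP.
  + by move=> a; rewrite F0; case: eqP => // ->; rewrite /= pu eqxx.
  + rewrite [leRHS](bigD1 (u 0%N))/=; last first.
      by rewrite pu eqxx/=; apply/existsP; exists (u N); exact: path_transfer_mx.
    rewrite F0 eqxx [X in _ <= _ + X]big1 ?addr0; last by move=> a /andP[_ /negPf ->].
    rewrite ler_piMr//; apply: le_trans W1.
    rewrite [leRHS](bigID (fun c => (p c == y 0%N) && [exists e, 0 < transfer_mx y N c e]))/=.
    by rewrite lerDl; apply: sumr_ge0 => a _.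
rewrite addnS FS WS /forward; case: ifP => _; last by rewrite mulr0.
rewrite mulr_sumr; apply: ler_sum => a _.
by rewrite mulrA ler_wpM2r.
Qed.

End transfer.

(** * Markov measures conditioned on a window *)

Section finite_partition.
Context d (X : measurableType d) (R : realType) (mu : probability X R).

Lemma measure_partition (I : finType) (f : X -> I) (E : set X) :
  measurable E -> (forall i, measurable (f @^-1` [set i])) ->
  mu E = (\sum_i mu (E `&` f @^-1` [set i]))%E.
Proof.
move=> mE mf.
have {1}-> : E = \bigcup_(i in [set: I]) (E `&` f @^-1` [set i]).
  by apply/seteqP; split => [x Ex|x [i _ []//]]; exists (f x).
rewrite measure_fin_bigcup//.
- rewrite (@fsbigE _ _ _ _ _ (index_enum I)) ?index_enum_uniq//.
    by apply: eq_bigl => i; rewrite in_setT.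
  by move=> i _; rewrite mem_index_enum.
- exact: finite_finset.
- by move=> i j _ _ [x [[_ <-] [_ <-]]].
- by move=> i _; exact: measurableI.
Qed.

Definition pr (E : set X) : R := fine (mu E).

Lemma prE E : measurable E -> mu E = (pr E)%:E.
Proof. by move=> mE; rewrite /pr fineK// fin_num_measure. Qed.

Lemma pr_ge0 E : 0 <= pr E.
Proof. by rewrite /pr fine_ge0. Qed.

Lemma pr_le E F : measurable E -> measurable F -> E `<=` F -> pr E <= pr F.
Proof.
by move=> mE mF EF; rewrite -lee_fin -!prE// le_measure ?inE.
Qed.

Lemma pr_le1 E : measurable E -> pr E <= 1.
Proof. by move=> mE; rewrite -lee_fin -prE// probability_le1. Qed.

Lemma pr_setT : pr setT = 1.
Proof. by rewrite /pr probability_setT. Qed.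

Lemma pr_set0 : pr set0 = 0.
Proof. by rewrite /pr measure0. Qed.

Lemma prU E F : measurable E -> measurable F -> E `&` F = set0 ->
  pr (E `|` F) = pr E + pr F.
Proof.
move=> mE mF EF; apply: EFin_inj; rewrite EFinD -!prE//; last exact: measurableU.
exact: measureU.
Qed.

Lemma pr_partition (I : finType) (f : X -> I) (E : set X) :
  measurable E -> (forall i, measurable (f @^-1` [set i])) ->
  pr E = \sum_i pr (E `&` f @^-1` [set i]).
Proof.
move=> mE mf; apply: EFin_inj; rewrite -prE// (measure_partition mE mf) -sumEFin.
by apply: eq_bigr => i _; rewrite prE//; exact: measurableI.
Qed.

End finite_partition.

Section markov_forward.
Variables (R : realType) (A : alphabetType) (B : alphabetType).
Variables (p : A -> B) (P : A -> A -> R) (mu : probability (seqspace A) R).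
Variable q : A -> R.
Hypothesis mu_cyl : forall n w, mu (@cylinder A n w) =
  (q (w 0%N) * \prod_(i < n) P (w i) (w i.+1))%:E.

Lemma cylinderS n w e : @cylinder A n w `&` [set x | x n.+1 = e] =
  cylinder n.+1 (fun i => if (i <= n)%N then w i else e).
Proof.
apply/seteqP; split => x.
  move=> [cx /= xe] i; case: (leqP i n) => [ni _|ni ni1]; first exact: cx.
  by have -> : i = n.+1 by [apply/eqP; rewrite eqn_leq ni1].
move=> cx; split => /= [i ni|]; first by rewrite cx ?leqW// ni.
by rewrite cx// ltnn.
Qed.

(** [mu] is known on cylinders only, so the event is split by its first [n + 1] letters; each piece
    is empty or a full cylinder. *)
Lemma markov_property n (E : set (seqspace A)) c e : finitary n E ->
  pr mu (E `&` [set x | x n = c] `&` [set x | x n.+1 = e]) =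
  pr mu (E `&` [set x | x n = c]) * P c e.
Proof.
move=> fE; pose F := E `&` [set x | x n = c].
have fF : finitary n F by apply: finitaryI => //; exact: (@finitary_coord _ _ [set c]).
have mF : measurable F by exact: finitary_measurable fF.
have mG : measurable (F `&` [set x | x n.+1 = e]).
  apply: measurableI => //; apply: (@finitary_measurable _ n.+1).
  exact: (@finitary_coord _ _ [set e]).
rewrite -/F (pr_partition mu mG (@measurable_first_word A n)).
rewrite (pr_partition mu mF (@measurable_first_word A n)) mulr_suml.
apply: eq_bigr => w _; rewrite preimage_first_word setIAC.
have [Fw|nFw] := pselect (F (pad w)); last first.
  have -> : F `&` cylinder n (pad w) = set0.
    rewrite -subset0 => x [Fx cx]; apply: nFw.
    by apply: fF Fx => i /cx.
  by rewrite set0I pr_set0 mul0r.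
have -> : F `&` cylinder n (pad w) = cylinder n (pad w).
  by apply/setIidPr => x cx; apply: fF Fw => i /cx.
rewrite cylinderS /pr !mu_cyl /= big_ord_recr/= leqnn ltnn mulrA.
have [_ /= ->] := Fw; congr (_ * _ * _).
by apply: eq_bigr => i _; rewrite ltnW// ltn_ord.
Qed.

Definition window (y : seqspace B) n : set (seqspace A) :=
  block_map p @^-1` cylinder n y.

Lemma finitary_window y n : finitary n (window y n).
Proof. apply: finitary_block_map; exact: finitary_cylinder. Qed.

Lemma measurable_window y n : measurable (window y n).
Proof. exact: finitary_measurable (@finitary_window y n). Qed.

Lemma windowS y n :
  window y n.+1 = window y n `&` [set x | p (x n.+1) = y n.+1].
Proof.
apply/seteqP; split => x.
  by move=> cx; split => [i /leqW|]; exact: cx.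
move=> [cx /= e] i; rewrite leq_eqVlt => /orP[/eqP ->//|]; exact: cx.
Qed.

(** As a row vector in [c] this follows [forward] once [n] is past the coordinates read by [C]; a
    conditional probability is a quotient of two total masses. *)
Definition joint_law C y n c := pr mu (C `&` window y n `&` [set x | x n = c]).

Lemma measurable_joint C y n c : is_finitary C ->
  measurable (C `&` window y n `&` [set x | x n = c]).
Proof.
move=> /is_finitary_measurable mC; apply: measurableI.
  by apply: measurableI => //; exact: measurable_window.
by apply: (@finitary_measurable _ n); exact: (@finitary_coord _ _ [set c]).
Qed.

Lemma joint_law_forward C k y n : finitary k C -> (k <= n)%N ->
  joint_law C y n.+1 = forward p P (y n.+1) (joint_law C y n).
Proof.
move=> fC kn; apply/funext => e; rewrite /joint_law /forward.
have [pe|pe] := eqVneq (p e) (y n.+1); last first.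
  rewrite [X in pr _ X](_ : _ = set0) ?pr_set0// -subset0 => x [[_ +] /= xe].
  by rewrite windowS => -[_ /=]; rewrite xe => /eqP; rewrite (negPf pe).
have fCw : finitary n (C `&` window y n).
  by apply: finitaryI; [exact: finitary_le fC|exact: finitary_window].
rewrite (pr_partition mu (f := fun x : seqspace A => x n)).
- apply: eq_bigr => c _; rewrite -markov_property//; congr (pr mu _).
  rewrite windowS; apply/seteqP; split => x /=.
    by move=> [[[? [? ?]] ?] ?].
  by move=> [[[? ?] ?] xe]; do !split => //; rewrite /= xe.
- by apply: measurable_joint; exists k.
- move=> c; apply: (@finitary_measurable _ n).
  exact: (@finitary_coord _ _ [set c]).
Qed.

Lemma joint_law_sum C y n : is_finitary C ->
  \sum_c joint_law C y n c = pr mu (C `&` window y n).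
Proof.
move=> fC; rewrite (pr_partition mu (f := fun x : seqspace A => x n))//.
  apply: measurableI; [exact: is_finitary_measurable|exact: measurable_window].
move=> c; apply: (@finitary_measurable _ n).
exact: (@finitary_coord _ _ [set c]).
Qed.

Lemma joint_law_support C y n c : p c != y n -> joint_law C y n c = 0.
Proof.
move=> pc; rewrite /joint_law [X in pr _ X](_ : _ = set0) ?pr_set0//.
rewrite -subset0 => x [[_ wx] /= xc]; move: pc; rewrite -(wx n (leqnn n)).
by rewrite /block_map xc eqxx.
Qed.

Lemma joint_law_le C y n c : is_finitary C ->
  0 <= joint_law C y n c <= joint_law setT y n c.
Proof.
move=> fC; rewrite pr_ge0/=; apply: pr_le; first exact: measurable_joint.
  by apply: measurable_joint; exact: is_finitary_setT.
by apply: setSI; exact: setSI.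
Qed.

End markov_forward.

(** * Uniform convergence of the conditional probabilities *)

Section conditional_ratio.
Variables (R : realType) (A B : alphabetType) (M : rel A) (p : A -> B).
Variables (P : A -> A -> R) (mu : probability (seqspace A) R) (q : A -> R).
Hypothesis stochP : stochastic P.
Hypothesis compP : compatible P M.
Hypothesis statq : stationary_vector P q.
Hypothesis mu_cyl : forall n w, mu (@cylinder A n w) =
  (q (w 0%N) * \prod_(i < n) P (w i) (w i.+1))%:E.
Hypothesis primM : primitive M.

(** Some letter has positive mass; stationarity carries positivity along allowed paths, and
    primitivity supplies one to each letter. *)
Lemma stationary_vector_gt0 a : 0 < q a.
Proof.
have [q0 q1 qP] := statq; have [n n0 Mn] := primM.
have [a0 qa0] : exists a0, 0 < q a0 by apply: sumr_gt0_ex => //; rewrite q1.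
rewrite -(enum_rankK a); have := Mn (enum_rank a0) (enum_rank a).
elim: n {n0 Mn} (enum_rank a) => [|n IH] j.
  by rewrite expr0 mxE; case: eqP => // <- _; rewrite enum_rankK.
rewrite exprSr mxE lt0n sum_nat_eq0 => /forallPn[k]; rewrite -lt0n muln_gt0.
move=> /andP[/IH qk]; rewrite mxE lt0b => /compP Pkj.
rewrite -qP; apply: (@sumr_gt0 _ _ _ (enum_val k)); last exact: mulr_gt0.
by move=> i; rewrite mulr_ge0//; exact: stochP.1.
Qed.

Lemma window_gt0 x n : SFT M x -> 0 < pr mu (window p (block_map p x) n).
Proof.
move=> Mx; apply: (@lt_le_trans _ _ (pr mu (cylinder n x))).
  rewrite /pr mu_cyl /= mulr_gt0 ?stationary_vector_gt0// prodr_gt0// => i _.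
  exact/compP/Mx.
apply: pr_le; [|exact: measurable_window|].
  by apply: finitary_measurable; exact: finitary_cylinder.
by move=> x' cx i /cx; rewrite /block_map => ->.
Qed.

(** On a null window the quotient is 0 by convention, so it stays in [0, 1] for every [y], also off
    the image of [SFT M]. *)
Definition cond_ratio C y n := pr mu (C `&` window p y n) / pr mu (window p y n).

Lemma ratio01 C y n : is_finitary C -> 0 <= cond_ratio C y n <= 1.
Proof.
move=> /is_finitary_measurable mC.
have mw := @measurable_window _ _ p y n.
rewrite divr_ge0 ?pr_ge0//=; have := pr_ge0 mu (window p y n).
rewrite le0r => /orP[/eqP w0|w0]; first by rewrite /cond_ratio w0 invr0 mulr0.
by rewrite ler_pdivrMr// mul1r; apply: pr_le => //; exact: measurableI.
Qed.

Variable N : nat.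
Hypothesis rectN : rectangle_time M p N.

Lemma ratio_cauchy C : is_finitary C -> forall e, 0 < e ->
  exists n0, forall x, SFT M x -> forall m n, (n0 <= m)%N -> (n0 <= n)%N ->
    `|cond_ratio C (block_map p x) m - cond_ratio C (block_map p x) n| <= e.
Proof.
move=> fC e e0; have [k fkC] := fC.
have [r /andP[r0 r1] H] := forward_contraction stochP compP rectN.
have [j rj] : exists j, r ^+ j < e.
  have /cvgrPdist_lt/(_ e e0)[j _ Hj] : r ^+ n @[n --> \oo] --> (0 : R).
    by apply: cvg_expr; rewrite ger0_norm.
  exists j; have := Hj j (leqnn j); rewrite /= sub0r normrN ger0_norm//.
  exact: exprn_ge0.
exists (k + j * N)%N => x Mx; set y := block_map p x.
have [|||c|a [b [a0 ab b1 bar HF]]] :=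
    H y k (joint_law p mu C y) (joint_law p mu setT y) _ _ _ _ j.
- by move=> m km; exact: (joint_law_forward p mu_cyl y fkC km).
- move=> m km; exact: (joint_law_forward (k := 0) p mu_cyl).
- by move=> c; exact: joint_law_support.
- exact: joint_law_le.
(* Summing the entrywise bracket over the last letter bounds the quotient of total masses; all late
   ratios share an interval of width at most [r ^+ j < e]. *)
have Hr n : (k + j * N <= n)%N -> a <= cond_ratio C y n <= b.
  move=> kn; have w0 := window_gt0 n Mx.
  rewrite ler_pdivlMr// ler_pdivrMr// -/y -(joint_law_sum p mu y n fC).
  rewrite -[window p y n]setTI -(joint_law_sum p mu y n (is_finitary_setT A)).
  rewrite !mulr_sumr; apply/andP; split; apply: ler_sum => c _;
  by have /andP[] := HF n c kn.
move=> m n /Hr/andP[am bm] /Hr/andP[an bn].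
by rewrite ler_norml; apply/andP; split; lra.
Qed.

(** The bound does not depend on [n], so it passes to the limit. The factor [q (x 0)] is the mass on
    the letter [x 0] at time 0. *)
Lemma ratio_coord_lower_bound x : SFT M x -> exists2 r, 0 < r &
  forall n, (N <= n)%N -> r <= cond_ratio [set x' | x' 0%N = x 0%N] (block_map p x) n.
Proof.
move=> Mx; set y := block_map p x.
have [r r0 H] := forward_lower_bound stochP compP rectN.
exists (r * q (x 0%N)); first by rewrite mulr_gt0// stationary_vector_gt0.
have fC : finitary 0 [set x' : seqspace A | x' 0%N = x 0%N].
  exact: (@finitary_coord _ _ [set x 0%N]).
have f1 : is_finitary [set x' : seqspace A | x' 0%N = x 0%N] by exists 0%N.
have cyl0 a : cylinder 0 (fun=> a) = [set x' : seqspace A | x' 0%N = a].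
  by apply/seteqP; split => x' /= => [/(_ 0%N)->//|e i]; rewrite leqn0 => /eqP ->.
have q0 := stationary_vector_gt0 (x 0%N).
have HF n c Nn := H y (joint_law p mu setT y) x (q (x 0%N)) _ _ _ _ _ (ltW q0)
  (joint_law p mu [set x' : seqspace A | x' 0%N = x 0%N] y) _ _ n c Nn.
move=> n Nn; have w0 := window_gt0 n Mx.
rewrite ler_pdivlMr// -/y -(joint_law_sum p mu y n f1).
rewrite -[window p y n]setTI -(joint_law_sum p mu y n (is_finitary_setT A)).
rewrite mulr_sumr; apply: ler_sum => c _; apply: HF => //.
- by move=> m; exact: (joint_law_forward (k := 0) p mu_cyl).
- by move=> a; exact: joint_law_support.
- by move=> a; exact: pr_ge0.
- rewrite joint_law_sum; last exact: is_finitary_setT.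
  by rewrite setTI; apply: pr_le1; exact: measurable_window.
- by move=> m; exact: (joint_law_forward p mu_cyl y fC (leq0n m)).
- apply/funext => a; rewrite /joint_law; case: eqP => [->|ne].
    rewrite (_ : _ `&` _ = cylinder 0 (fun=> x 0%N)); last first.
      rewrite cyl0; apply/seteqP; split => x' /=; first by case.
      move=> e; split => //; split => // i; rewrite leqn0 => /eqP ->.
      by rewrite /y /block_map e.
    by rewrite /pr mu_cyl big_ord0 mulr1.
  rewrite (_ : _ `&` _ = set0) ?pr_set0// -subset0 => x' /= [[-> _] e].
  exact: ne.
Qed.

Lemma ratio_limit : exists l : set (seqspace A) -> seqspace B -> R,
  forall C, is_finitary C -> forall e, 0 < e -> exists n0, forall x, SFT M x ->
    forall n, (n0 <= n)%N ->
      `|cond_ratio C (block_map p x) n - l C (block_map p x)| <= e.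
Proof.
exists (fun C y => limn (cond_ratio C y)) => C fC e e0.
have [n0 Hn0] := ratio_cauchy fC e0; exists n0 => x Mx n n0n.
set y := block_map p x.
have cv : cvgn (cond_ratio C y).
  apply/cauchy_cvgP/cauchy_exP => d d0.
  have d20 : 0 < d / 2 by lra.
  have [m Hm] := ratio_cauchy fC d20; exists (cond_ratio C y m), m => // i /= mi.
  rewrite /ball/=; apply: le_lt_trans (Hm x Mx _ _ (leqnn m) mi) _; lra.
(* The limit is reached through an index large enough for both the Cauchy bound and closeness [d],
   with [d] arbitrary. *)
apply/ler_addgt0Pr => d d0.
have /cvgrPdist_lt/(_ d d0)[m _ Hm] := cv.
have := Hm (maxn m n0) (leq_maxl _ _).
have := Hn0 x Mx n (maxn m n0) n0n (leq_maxr _ _).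
rewrite -/y /= ltr_norml !ler_norml => /andP[? ?] /andP[? ?].
by apply/andP; split; lra.
Qed.

End conditional_ratio.

(** * The fibre measures *)

Section full_measure.
Context d (X : measurableType d) (R : realType) (m : probability X R).

Lemma measure_setC_full D : measurable D -> m D = 1%E -> m (~` D) = 0%E.
Proof. by move=> mD D1; rewrite [LHS]probability_setC// D1 subee. Qed.

Lemma measure_setI_full D E : measurable D -> measurable E -> m D = 1%E ->
  m (E `&` D) = m E.
Proof.
move=> mD mE D1; rewrite [in RHS](measureDI m mE mD) [X in (X + _)%E](_ : _ = 0%E) ?add0e//.
apply: (@subset_measure0 _ _ _ _ _ (~` D)) => //.
- exact: measurableD.
- exact: measurableC.
- exact: measure_setC_full.
Qed.

(** Positive and negative parts are treated separately, so the identity also covers non-integrable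
    functions. *)
Lemma integral_full D (h : X -> \bar R) : measurable D -> m D = 1%E ->
  measurable_fun setT h -> (\int[m]_(x in D) h x = \int[m]_x h x)%E.
Proof.
move=> mD D1 mh.
have H f : measurable_fun setT f -> (forall x, 0 <= f x)%E ->
    (\int[m]_(x in D) f x = \int[m]_x f x)%E.
  move=> mf f0; rewrite [RHS](@ge0_negligible_integral _ _ _ _ _ (~` D))//.
  - by rewrite setTD setCK.
  - exact: measurableC.
  - exact: measure_setC_full.
rewrite integralE [RHS]integralE; congr (_ - _)%E; apply: H => //.
  exact: measurable_funepos.
exact: measurable_funeneg.
Qed.

End full_measure.

Section fibre_kernel.
Variables (R : realType) (A B : alphabetType) (M : rel A) (M' : rel B).
Variables (p : A -> B) (mu : probability (seqspace A) R).
Hypothesis window_pos : forall x n, SFT M x ->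
  0 < pr mu (window p (block_map p x) n).
Hypothesis img : block_map p @` SFT M = SFT M'.
Hypothesis muM : mu (SFT M) = 1%E.

Lemma ratio_setT y n : SFT M' y -> cond_ratio p mu setT y n = 1.
Proof.
rewrite -img => -[x Mx <-]; rewrite /cond_ratio setTI divff// gt_eqF//.
exact: window_pos.
Qed.

Lemma ratioU C D y n : is_finitary C -> is_finitary D -> C `&` D = set0 ->
  cond_ratio p mu (C `|` D) y n = cond_ratio p mu C y n + cond_ratio p mu D y n.
Proof.
move=> /is_finitary_measurable mC /is_finitary_measurable mD CD.
have mw := @measurable_window _ _ p y n.
rewrite /cond_ratio setIUl prU ?mulrDl//; [exact: measurableI|exact: measurableI|].
by rewrite setIACA CD set0I.
Qed.

Lemma fibre_kernel_exists (l : set (seqspace A) -> seqspace B -> R) :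
  (forall C, is_finitary C -> forall e, 0 < e -> exists n0, forall x, SFT M x ->
    forall n, (n0 <= n)%N ->
      `|cond_ratio p mu C (block_map p x) n - l C (block_map p x)| <= e) ->
  exists kappa : seqspace B -> probability (seqspace A) R,
  (forall y, ~ SFT M' y -> kappa y = mu) /\
  forall C, is_finitary C -> forall e, 0 < e -> exists n0, forall y, SFT M' y ->
    forall n, (n0 <= n)%N -> `|cond_ratio p mu C y n - pr (kappa y) C| <= e.
Proof.
move=> Hl.
have cvl C y : is_finitary C -> SFT M' y -> cond_ratio p mu C y n @[n --> \oo] --> l C y.
  move=> fC; rewrite -img => -[x Mx <-]; apply/cvgrPdist_le => e e0.
  have [n0 Hn0] := Hl C fC e e0; exists n0 => // n /= n0n.
  by rewrite distrC; exact: Hn0.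
have ex y : exists k : probability (seqspace A) R, (~ SFT M' y -> k = mu) /\
    (SFT M' y -> forall C, is_finitary C -> pr k C = l C y).
  (* The constant value [mu] off [SFT M'] keeps the kernel measurable on the whole space. *)
  have [My|nMy] := pselect (SFT M' y); last by exists mu.
  (* The extension theorem asks for nonnegativity on all sets, whereas [l] is controlled on finitary
     ones only. *)
  pose l' C := if pselect (is_finitary C) then l C y else 0.
  have l'E C : is_finitary C -> l' C = l C y by rewrite /l'; case: pselect.
  have [|||k Hk] := @finitary_extension A R l'.
  - move=> C; rewrite /l'; case: pselect => // fC.
    have /cvg_lim <- // := cvl _ _ fC My.
    apply: limr_ge; [exact: cvgP (cvl _ _ fC My)|apply: nearW => n].
    by have /andP[] := @ratio01 _ _ _ p mu C y n fC.
  - move=> C D fC fD CD; have fU := is_finitary_setU fC fD; rewrite !l'E//.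
    have h := cvl _ _ fU My; apply: (cvg_unique _ h) => //.
    rewrite (_ : cond_ratio _ _ _ _ = cond_ratio p mu C y \+ cond_ratio p mu D y).
      by apply: cvgD; exact: cvl.
    by apply/funext => n; exact: ratioU.
  - rewrite l'E; last exact: is_finitary_setT.
    have := cvl _ _ (@is_finitary_setT A) My; move/cvg_lim => <- //.
    by under eq_fun do rewrite ratio_setT//; exact: lim_cst.
  - by exists k; split => // _ C fC; rewrite /pr Hk//= l'E.
have [kappa Hk] := choice ex; exists kappa; split => [y|C fC e e0].
  by have [H _] := Hk y; exact: H.
have [n0 Hn0] := Hl C fC e e0; exists n0 => y My n n0n.
have [_ ->] := Hk y => //; move: My; rewrite -img => -[x Mx <-]; exact: Hn0.
Qed.

Variable kappa : seqspace B -> probability (seqspace A) R.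
Hypothesis kappa_off : forall y, ~ SFT M' y -> kappa y = mu.
Hypothesis kappa_lim : forall C, is_finitary C -> forall e, 0 < e ->
  exists n0, forall y, SFT M' y -> forall n, (n0 <= n)%N ->
    `|cond_ratio p mu C y n - pr (kappa y) C| <= e.

Lemma kappa_cvg C y : is_finitary C -> SFT M' y ->
  cond_ratio p mu C y n @[n --> \oo] --> pr (kappa y) C.
Proof.
move=> fC My; apply/cvgrPdist_le => e e0.
have [n0 Hn0] := kappa_lim fC e0; exists n0 => // n /= n0n.
by rewrite distrC; exact: Hn0.
Qed.

Lemma fibreE y :
  fibre (SFT M) p y = \bigcap_n (window p y n `&` [set x | M (x n) (x n.+1)]).
Proof.
apply/seteqP; split => x.
  by move=> [Mx <-] n _; split; [|exact: Mx].
move=> H; split => [n|]; first by case: (H n I).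
by apply/funext => n; have [w _] := H n I; exact: w.
Qed.

Lemma finitary_edge n : finitary n.+1 [set x : seqspace A | M (x n) (x n.+1)].
Proof. by move=> x x' xx' /=; rewrite !xx'. Qed.

Lemma measurable_fibre y : measurable (fibre (SFT M) p y).
Proof.
rewrite fibreE; apply: bigcapT_measurable => n; apply: measurableI.
  exact: measurable_window.
by apply: (@finitary_measurable _ n.+1); exact: finitary_edge.
Qed.

(** Up to the null complement of [SFT M], late windows lie inside [C], so the ratios are eventually
    1. *)
Lemma kappa_one y C n0 : is_finitary C -> SFT M' y ->
  (forall n, (n0 <= n)%N -> window p y n `&` SFT M `<=` C) -> kappa y C = 1%E.
Proof.
move=> fC My HC; have mC := is_finitary_measurable fC.
rewrite prE//; congr EFin.
have /cvg_lim <- // := kappa_cvg fC My.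
apply: lim_near_cst => //; exists n0 => // n /= n0n.
rewrite -(ratio_setT n My) /cond_ratio setTI; congr (_ / _).
have mw := @measurable_window _ _ p y n.
have mS := measurable_SFT M.
rewrite /pr; congr fine.
rewrite -(measure_setI_full mS _ muM); last exact: measurableI.
rewrite -[RHS](measure_setI_full mS mw muM); congr (mu _).
rewrite -setIA; apply/setIidPr; exact: HC.
Qed.

(** The fibre is a countable intersection of finitary conditions, each implied by all late windows
    within [SFT M]. *)
Lemma kappa_fibre y : SFT M' y -> kappa y (fibre (SFT M) p y) = 1%E.
Proof.
move=> My; rewrite fibreE.
have fD n : is_finitary (window p y n `&` [set x | M (x n) (x n.+1)]).
  apply: is_finitary_setI; first by exists n; exact: finitary_window.
  by exists n.+1; exact: finitary_edge.
have mD n := is_finitary_measurable (fD n).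
have D1 n : kappa y (window p y n `&` [set x | M (x n) (x n.+1)]) = 1%E.
  apply: (@kappa_one y _ n) => // m nm x [wx Mx]; split; last exact: Mx.
  by move=> i ni; apply: wx; exact: leq_trans nm.
have mcap := bigcapT_measurable mD.
have c0 : kappa y (~` \bigcap_n (window p y n `&` [set x | M (x n) (x n.+1)])) = 0%E.
  apply/negligibleP; first exact: measurableC.
  rewrite setC_bigcap; apply: negligible_bigcup => n.
  by apply/negligibleP; [exact: measurableC|exact: measure_setC_full].
by rewrite -[X in kappa y X]setCK probability_setC ?c0 ?sube0//; exact: measurableC.
Qed.

End fibre_kernel.

Lemma measurable_fun_finitary (T : alphabetType) d (Y : measurableType d) n
    (f : seqspace T -> Y) :
  (forall x x', (forall i, (i <= n)%N -> x i = x' i) -> f x = f x') ->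
  measurable_fun setT f.
Proof.
move=> Hf _ V _; rewrite setTI; apply: (@finitary_measurable _ n).
by move=> x x' /Hf /= ->.
Qed.

(** * The disintegration identity *)

Section disintegration.
Variables (R : realType) (A B : alphabetType) (M : rel A) (M' : rel B).
Variables (p : A -> B) (mu : probability (seqspace A) R).
Hypothesis img : block_map p @` SFT M = SFT M'.
Hypothesis muM : mu (SFT M) = 1%E.
Variable kappa : seqspace B -> probability (seqspace A) R.
Hypothesis kappa_off : forall y, ~ SFT M' y -> kappa y = mu.
Hypothesis kappa_fib : forall y, SFT M' y -> kappa y (fibre (SFT M) p y) = 1%E.
Hypothesis kappa_cvg : forall C y, is_finitary C -> SFT M' y ->
  cond_ratio p mu C y n @[n --> \oo] --> pr (kappa y) C.

Notation nu := (distribution mu (block_map p)).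

Lemma nu_SFT : nu (SFT M') = 1%E.
Proof.
have mS' := measurable_SFT M'; have mS := measurable_SFT M.
apply/eqP; rewrite eq_le probability_le1//= -muM.
apply: le_measure; rewrite ?inE//.
  by rewrite -[X in measurable X]setTI; exact: measurable_block_map.
by move=> x Mx; rewrite /= -img; exists x.
Qed.

Lemma measurable_cond_ratio C n :
  measurable_fun setT (fun y => (cond_ratio p mu C y n)%:E).
Proof.
apply: (@measurable_fun_finitary _ _ _ n) => y y' yy'.
rewrite /cond_ratio; have -> // : window p y n = window p y' n.
by apply/seteqP; split => x wx i ni; rewrite wx// yy'.
Qed.

Lemma measurable_kappa E : measurable E -> measurable_fun setT (fun y => kappa y E).
Proof.
move: E; apply: finitary_induction.
- move=> C fC; rewrite -(setUv (SFT M')); have mS' := measurable_SFT M'.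
  apply/measurable_funU => //; first exact: measurableC.
  split.
    apply: (emeasurable_fun_cvg (fun n y => (cond_ratio p mu C y n)%:E)).
      by move=> n; apply: measurable_funTS; exact: measurable_cond_ratio.
    move=> y My; rewrite prE; last exact: is_finitary_measurable.
    by apply: cvg_EFin; [apply: nearW|exact: kappa_cvg].
  apply: (eq_measurable_fun (fun=> mu C)); last exact: measurable_cst.
  by move=> y; rewrite inE => /kappa_off ->.
- move=> C mC HC; under eq_fun do rewrite probability_setC//.
  exact: emeasurable_funB.
- move=> F mF tF HF.
  apply: (eq_measurable_fun (fun y => \sum_(0 <= k <oo) kappa y (F k))%E).
    by move=> y _; rewrite measure_semi_bigcup//; exact: bigcup_measurable.
  by apply: ge0_emeasurable_sum => // k y _ _.
Qed.

(** In the Giry monad, measurability of integrals against [kappa y] and the iterated integral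
    formula come from its general theory. *)
Lemma measurable_kappa_giry :
  measurable_fun setT (fun y => kappa y : giry (seqspace A) R).
Proof. by apply: measurable_giry_codensity => // E mE; exact: measurable_kappa. Qed.

(** The law of total probability for one window length: the ratio is constant on each cylinder of
    [y]. *)
Lemma integral_cond_ratio C n : is_finitary C ->
  (\int[nu]_y (cond_ratio p mu C y n)%:E = mu C)%E.
Proof.
move=> fC; have mC := is_finitary_measurable fC.
transitivity (\int[nu]_y \sum_(w : {ffun 'I_n.+1 -> B})
    (cond_ratio p mu C (pad w) n * \1_(first_word n @^-1` [set w]) y)%:E)%E.
  apply: eq_integral => y _; rewrite (bigD1 (first_word n y))//= big1 ?adde0.
    rewrite indicE mem_set//= mulr1 /cond_ratio; congr (_ / _)%:E;
    congr (pr _ _); [congr (_ `&` _)|];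
    by apply/seteqP; split => x wx i ni; rewrite wx// (@cylinder_pad _ n y i ni).
  by move=> w wy; rewrite indicE memNset ?mulr0//= => e; rewrite e eqxx in wy.
rewrite ge0_integral_sum//; last 2 first.
- move=> w; apply/measurable_EFinP; apply: measurable_funM => //.
  by apply: measurable_indic; exact: measurable_first_word.
- by move=> w y _; rewrite lee_fin mulr_ge0//; have /andP[] := @ratio01 _ _ _ p mu C (pad w) n fC.
rewrite (measure_partition mu (f := first_word n \o block_map p) mC); last first.
  move=> w; rewrite -[X in measurable X]setTI.
  exact: measurable_block_map (measurable_first_word w).
apply: eq_bigr => w _; under eq_integral do rewrite EFinM.
rewrite ge0_integralZl_EFin//; last 2 first.
- by apply/measurable_EFinP/measurable_indic; exact: measurable_first_word.
- by have /andP[] := @ratio01 _ _ _ p mu C (pad w) n fC.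
rewrite integral_indic//; last exact: measurable_first_word.
rewrite setIT preimage_first_word comp_preimage preimage_first_word.
have mw := @measurable_window _ _ p (pad w) n.
rewrite [in RHS]prE; last exact: measurableI.
rewrite -[X in (_ * X)%E]/(mu (window p (pad w) n)) (prE mu mw) -EFinM.
congr EFin; rewrite /cond_ratio.
(* On a null window the event inside it is null as well, so the conventional value 0 does no
   harm. *)
have [w0|w0] := eqVneq (pr mu (window p (pad w) n)) 0; last by rewrite divfK.
rewrite w0 mulr0; apply/esym/eqP; rewrite eq_le pr_ge0 andbT -w0.
by apply: pr_le => //; exact: measurableI.
Qed.

(** Dominated convergence, with bound 1, in a sequence of integrals that are all equal to [mu C]. *)
Lemma integral_kappa_finitary C : is_finitary C -> (\int[nu]_y kappa y C = mu C)%E.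
Proof.
move=> fC; have mC := is_finitary_measurable fC.
have mS' := measurable_SFT M'.
have [|||_ _] := @dominated_convergence _ _ _ nu (SFT M') mS'
  (fun n y => (cond_ratio p mu C y n)%:E) (fun y => kappa y C) (cst 1%E)
  (fun n => measurable_funTS (@measurable_cond_ratio C n))
  (measurable_funTS (measurable_kappa mC)).
- apply: aeW => y My; rewrite prE//.
  by apply: cvg_EFin; [apply: nearW|exact: kappa_cvg].
- exact: finite_measure_integrable_cst.
- apply: aeW => y n _; rewrite lee_fin.
  by have /andP[? ?] := @ratio01 _ _ _ p mu C y n fC; rewrite ger0_norm.
rewrite (integral_full mS' nu_SFT (measurable_kappa mC)) => H.
apply: (cvg_unique _ H) => //; apply: cvg_near_cst; apply: nearW => n.
rewrite -(integral_cond_ratio n fC); apply: integral_full => //.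
  exact: nu_SFT.
exact: measurable_cond_ratio.
Qed.

(** The mixture of the [kappa y] under [nu] is a measure agreeing with [mu] on the pi-system of
    finitary sets. *)
Lemma integral_kappa_ge0 (h : seqspace A -> \bar R) : measurable_fun setT h ->
  (forall x, 0 <= h x)%E ->
  (\int[nu]_y \int[kappa y]_x h x = \int[mu]_x h x)%E.
Proof.
move=> mh h0; have H := giry_int_bind nu measurable_kappa_giry mh h0.
rewrite -[LHS]/(giry_int nu (fun y => giry_int (kappa y) h)) -H /giry_int.
apply: eq_measure_integral => E mE _.
apply: (measure_unique (@is_finitary A) (fun=> setT)) => //.
- exact: measurable_finitary.
- exact: is_finitary_setI.
- by move=> _; exact: is_finitary_setT.
- by rewrite bigcup_const//; exists 0%N.
- move=> C fC.
  transitivity (\int[nu]_y kappa y C)%E; last exact: integral_kappa_finitary.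
  rewrite /giry_bind/=; apply: giry_int_map => //.
  by apply: measurable_giry_ev; exact: is_finitary_measurable.
- by move=> _; apply: le_lt_trans (@sprobability_setT _ _ _ _) (ltry _).
Qed.

Lemma fibre_integralE f y : measurable_fun (SFT M) f -> SFT M' y ->
  fibre_integral p (SFT M) kappa f y =
  (\int[kappa y]_x ((EFin \o f) \_ (SFT M)) x)%E.
Proof.
move=> mf My; have mS := measurable_SFT M.
rewrite -(integral_full (measurable_fibre M p y) (kappa_fib My)); last first.
  by apply/measurable_restrict => //; rewrite setTI; exact/measurable_EFinP.
apply: eq_integral => x; rewrite inE => -[Mx _]; rewrite patchE mem_set//.
Qed.

Lemma kappa_disintegration : disintegration p (SFT M) (SFT M') mu kappa.
Proof.
split=> // f fint; have mS := measurable_SFT M; have mS' := measurable_SFT M'.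
have mf : measurable_fun (SFT M) f by apply/measurable_EFinP; exact: measurable_int fint.
pose g := (EFin \o f) \_ (SFT M).
have mg : measurable_fun setT g.
  by apply/measurable_restrict => //; rewrite setTI; exact/measurable_EFinP.
have gint : mu.-integrable setT g by apply/integrable_restrict => //; rewrite setTI.
pose I y := (\int[kappa y]_x g x)%E.
pose Ip y := (\int[kappa y]_x g^\+ x)%E; pose In y := (\int[kappa y]_x g^\- x)%E.
have mgp := measurable_funepos mg; have mgn := measurable_funeneg mg.
have mI h : measurable_fun setT h -> (forall x, 0 <= h x)%E ->
    measurable_fun setT (fun y => \int[kappa y]_x h x)%E.
  move=> mh h0; apply: (@measurableT_comp _ _ _ _ _ _ (giry_int ^~ h)) => //.
    exact: measurable_giry_int.
  exact: measurable_kappa_giry.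
have mIp : measurable_fun setT Ip by exact: mI.
have mIn : measurable_fun setT In by exact: mI.
have IE : I = (fun y => Ip y - In y)%E by apply/funext => y; exact: integralE.
have mII : measurable_fun setT I by rewrite IE; exact: emeasurable_funB.
split.
  apply: (eq_measurable_fun I); last exact: measurable_funTS.
  by move=> y; rewrite inE => My; rewrite fibre_integralE.
transitivity (\int[nu]_(y in SFT M') I y)%E; last first.
  by apply: eq_integral => y; rewrite inE => My; rewrite fibre_integralE.
rewrite (integral_full mS' nu_SFT mII) IE integral_mkcond -/g integralE.
(* The inner integrals may be infinite for a null set of [y]; integrability of both parts under [nu]
   justifies integrating their difference termwise. *)
have fin h : measurable_fun setT h -> (forall x, 0 <= h x)%E ->
    mu.-integrable setT h -> nu.-integrable setT (fun y => \int[kappa y]_x h x)%E.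
  move=> mh h0 /integrableP[_ hoo]; apply/integrableP; split; first exact: mI.
  under eq_integral do rewrite gee0_abs ?integral_ge0//.
  rewrite integral_kappa_ge0//; apply: le_lt_trans hoo.
  by under [leRHS]eq_integral do rewrite gee0_abs//.
rewrite integralB//; last 2 first.
  by apply: fin => //; exact: integrable_funepos.
  by apply: fin => //; exact: integrable_funeneg.
by rewrite !integral_kappa_ge0.
Qed.

End disintegration.

(** * Continuity of the fibre integrals *)

Lemma within_continuous_cylinderP (R : realType) (T : alphabetType)
    (S : set (seqspace T)) (f : seqspace T -> R) :
  {within S, continuous f} <->
  (forall x, S x -> forall e, 0 < e ->
    exists n, forall x', S x' -> cylinder n x x' -> `|f x - f x'| <= e).
Proof.
split=> [/subspace_continuousP fS x Sx e e0|H].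
  have /cvgrPdist_le/(_ e e0) := fS x Sx.
  rewrite /prop_near1 /within/= => /nbhs_sub_cylinder[n Hn].
  by exists n => x' Sx' /Hn; apply.
apply/subspace_continuousP => x Sx; apply/cvgrPdist_le => e e0.
have [n Hn] := H x Sx e e0.
rewrite /prop_near1 /within/=; apply: filterS (nbhs_cylinder n x).
by move=> x' cx Sx'; exact: Hn.
Qed.

Section continuous_functions.
Variables (R : realType) (A : alphabetType) (M : rel A).
Variable f : seqspace A -> R.
Hypothesis fcont : {within SFT M, continuous f}.

(** Heine-Cantor through König's lemma: ever closer pairs with values more than [e] apart would
    accumulate at a point of [SFT M] where [f] is discontinuous. *)
Lemma SFT_uniform_continuous e : 0 < e -> exists N, forall x x',
  SFT M x -> SFT M x' -> cylinder N x x' -> `|f x - f x'| <= e.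
Proof.
move=> e0; apply: contrapT => /forallNP noN.
pose D n := [set x : nat -> A | (forall i, (i < n)%N -> M (x i) (x i.+1)) /\
  exists x1 x2, [/\ SFT M x1 /\ SFT M x2, cylinder n x x1, cylinder n x x2 &
    e < `|f x1 - f x2|]].
have [||n|z Dz] := @konig A D.
- move=> n x [xM [x1 [x2 [S12 c1 c2 ne]]]]; split.
    by move=> i /leqW; exact: xM.
  exists x1, x2; split => // i /leqW; [exact: c1|exact: c2].
- move=> n x x' xx' [xM [x1 [x2 [S12 c1 c2 ne]]]]; split.
    by move=> i ni; rewrite -!xx'//; [exact: xM|exact: ltnW].
  by exists x1, x2; split => // i ni; rewrite -xx'//; [exact: c1|exact: c2].
- have /existsNP[x /existsNP[x' ]] := noN n.
  move=> /not_implyP[Mx /not_implyP[Mx' /not_implyP[cx /negP]]].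
  rewrite -ltNge => lt; exists x; split; first by move=> i _; exact: Mx.
  by exists x, x'.
have Mz : SFT M z by move=> n; have [zM _] := Dz n.+1; exact: zM.
have e20 : 0 < e / 2 by lra.
have /within_continuous_cylinderP/(_ z Mz _ e20)[n Hn] := fcont.
have [_ [x1 [x2 [[M1 M2] /(Hn _ M1) d1 /(Hn _ M2) d2]]]] := Dz n.
apply/negP; rewrite -leNgt.
rewrite (_ : f x1 - f x2 = (f z - f x2) - (f z - f x1)); last ring.
by apply: le_trans (ler_normB _ _) _; lra.
Qed.

Lemma SFT_finitary_approx e : 0 < e ->
  exists N (phi : {ffun 'I_N.+1 -> A} -> R), forall x, SFT M x ->
    `|f x - phi (first_word N x)| <= e.
Proof.
move=> /SFT_uniform_continuous[N HN].
have ex (w : {ffun 'I_N.+1 -> A}) : exists r, forall x, SFT M x ->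
    first_word N x = w -> `|f x - r| <= e.
  (* The value of [f] at any point beginning with [w] serves; a word that begins no point gets 0. *)
  have [[x0 [Mx0 x0w]]|none] := pselect (exists x0, SFT M x0 /\ first_word N x0 = w).
    exists (f x0) => x Mx xw; apply: HN => // i iN.
    by rewrite (cylinder_pad x0 iN) x0w -xw -(cylinder_pad x iN).
  by exists 0 => x Mx xw; exfalso; apply: none; exists x.
have [phi Hphi] := choice ex; exists N, phi => x Mx; exact: Hphi.
Qed.

Lemma measurable_fun_continuous_SFT : measurable_fun (SFT M) f.
Proof.
have ex (k : nat) : exists s : seqspace A -> R, measurable_fun setT s /\
    forall x, SFT M x -> `|f x - s x| <= k.+1%:R^-1.
  have [|N [phi Hphi]] := @SFT_finitary_approx k.+1%:R^-1; first by rewrite invr_gt0.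
  exists (phi \o first_word N); split => //.
  apply: (@measurable_fun_finitary _ _ _ N) => x x' xx' /=; congr phi.
  by apply/ffunP => i; rewrite !ffunE; apply: xx'; rewrite -ltnS.
have [s Hs] := choice ex.
apply: (@measurable_fun_cvg _ _ _ _ s) => [m|x Mx].
  by apply: measurable_funTS; have [] := Hs m.
apply/cvgrPdist_le => e e0.
apply: filterS (near_infty_natSinv_lt (PosNum e0)) => m /= me.
by have [_ /(_ x Mx) H] := Hs m; apply: le_trans H _; exact: ltW.
Qed.

End continuous_functions.

Section finitary_integral.
Variables (R : realType) (A : alphabetType) (m : probability (seqspace A) R).
Variables (N : nat) (phi : {ffun 'I_N.+1 -> A} -> R).

Lemma measurable_first_word_fun : measurable_fun setT (phi \o first_word N).
Proof.
apply: (@measurable_fun_finitary _ _ _ N) => x x' xx' /=; congr phi.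
by apply/ffunP => i; rewrite !ffunE; apply: xx'; rewrite -ltnS.
Qed.

Lemma first_word_fun_bound x : `|phi (first_word N x)| <= \sum_w `|phi w|.
Proof. by rewrite (bigD1 (first_word N x))//= lerDl sumr_ge0. Qed.

Lemma integrable_first_word_fun D : measurable D ->
  m.-integrable D (EFin \o (phi \o first_word N)).
Proof.
move=> mD; apply: (le_integrable mD _ _
  (finite_measure_integrable_cst m (\sum_w `|phi w|) mD)).
  by apply/measurable_EFinP; apply: measurable_funTS; exact: measurable_first_word_fun.
move=> x _ /=; rewrite lee_fin (le_trans (first_word_fun_bound x))//.
exact: ler_norm.
Qed.

Lemma integral_first_word_fun :
  (\int[m]_x (phi (first_word N x))%:E =
   (\sum_w phi w * pr m (first_word N @^-1` [set w]))%:E)%E.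
Proof.
have mI w : measurable_fun setT (fun x => (\1_(first_word N @^-1` [set w]) x : R)%:E).
  by apply/measurable_EFinP/measurable_indic; exact: measurable_first_word.
have iI w : m.-integrable setT (fun x => (\1_(first_word N @^-1` [set w]) x : R)%:E).
  apply: (le_integrable measurableT _ _
    (finite_measure_integrable_cst m 1 measurableT)); first exact: mI.
  move=> x _ /=; by rewrite indicE lee_fin normr1; case: (_ \in _); rewrite ?normr1 ?normr0.
transitivity (\int[m]_x \sum_(w : {ffun 'I_N.+1 -> A})
    ((phi w)%:E * (\1_(first_word N @^-1` [set w]) x)%:E))%E.
  apply: eq_integral => x _; rewrite (bigD1 (first_word N x))//= big1 ?adde0.
    by rewrite indicE mem_set//= mule1.
  by move=> w wx; rewrite indicE memNset ?mule0//= => e; rewrite e eqxx in wx.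
rewrite integral_sum//; last by move=> w; exact: integrableZl.
rewrite -sumEFin; apply: eq_bigr => w _; rewrite integralZl// EFinM.
rewrite integral_indic//; last exact: measurable_first_word.
by rewrite setIT; congr (_ * _)%E; exact: prE (measurable_first_word w).
Qed.

End finitary_integral.

Section fibre_integral_continuity.
Variables (R : realType) (A B : alphabetType) (M : rel A) (M' : rel B).
Variables (p : A -> B) (mu : probability (seqspace A) R).
Variable kappa : seqspace B -> probability (seqspace A) R.
Hypothesis kappa_fib : forall y, SFT M' y -> kappa y (fibre (SFT M) p y) = 1%E.
Hypothesis kappa_lim : forall C, is_finitary C -> forall e, 0 < e ->
  exists n0, forall y, SFT M' y -> forall n, (n0 <= n)%N ->
    `|cond_ratio p mu C y n - pr (kappa y) C| <= e.

(** Sequences agreeing up to [n] have the same ratio at [n], and that ratio is uniformly close to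
    both limits. *)
Lemma kappa_continuous C : is_finitary C -> forall e, 0 < e ->
  exists n, forall y y', SFT M' y -> SFT M' y' -> cylinder n y y' ->
    `|pr (kappa y) C - pr (kappa y') C| <= e.
Proof.
move=> fC e e0; have e20 : 0 < e / 2 by lra.
have [n Hn] := kappa_lim fC e20; exists n => y y' My My' cy.
have := Hn y My n (leqnn n); have := Hn y' My' n (leqnn n).
have -> : cond_ratio p mu C y n = cond_ratio p mu C y' n.
  rewrite /cond_ratio; have -> // : window p y n = window p y' n.
  by apply/seteqP; split => x wx i ni; rewrite wx// cy.
by rewrite !ler_norml => /andP[? ?] /andP[? ?]; apply/andP; split; lra.
Qed.

Lemma fibre_integral_approx (f : seqspace A -> R) N
    (phi : {ffun 'I_N.+1 -> A} -> R) e y :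
  measurable_fun (SFT M) f -> 0 <= e ->
  (forall x, SFT M x -> `|f x - phi (first_word N x)| <= e) -> SFT M' y ->
  `|\int[kappa y]_(x in fibre (SFT M) p y) f x -
    \sum_w phi w * pr (kappa y) (first_word N @^-1` [set w])| <= e.
Proof.
move=> mf e0 fphi My; have mF := measurable_fibre M p y.
set D := fibre _ _ _; have D1 : kappa y D = 1%E := kappa_fib My.
have DM : D `<=` SFT M by move=> x [].
have mfD : measurable_fun D f.
  by apply: measurable_funS mf => //; exact: measurable_SFT.
have iphi := integrable_first_word_fun (kappa y) phi mF.
have bound x : D x -> `|f x| <= e + \sum_w `|phi w|.
  move=> /DM Mx; rewrite -[f x](subrK (phi (first_word N x))).
  apply: le_trans (ler_normD _ _) _; apply: lerD; first exact: fphi.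
  exact: first_word_fun_bound.
have if_ : (kappa y).-integrable D (EFin \o f).
  apply: (le_integrable mF _ _
    (finite_measure_integrable_cst (kappa y) (e + \sum_w `|phi w|) mF)).
    exact/measurable_EFinP.
  by move=> x Dx /=; rewrite lee_fin (le_trans (bound x Dx))// ler_norm.
have -> : \sum_w phi w * pr (kappa y) (first_word N @^-1` [set w]) =
    \int[kappa y]_(x in D) phi (first_word N x).
  rewrite /Rintegral (integral_full mF D1) ?integral_first_word_fun//.
  by apply/measurable_EFinP; exact: measurable_first_word_fun.
rewrite -RintegralB//.
have ifp : (kappa y).-integrable D (EFin \o (fun x => f x - phi (first_word N x))).
  by have := integrableB mF if_ iphi.
apply: le_trans (le_normr_Rintegral mF ifp) _.
apply: (@le_trans _ _ (\int[kappa y]_(x in D) (cst e x))).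
  apply: le_Rintegral => //; last by move=> x /DM Mx; exact: fphi.
    exact: integrable_abse ifp.
  exact: finite_measure_integrable_cst.
by rewrite Rintegral_cst// [fine _](congr1 fine D1) mulr1.
Qed.

Lemma fibre_integral_continuous (f : seqspace A -> R) : {within SFT M, continuous f} ->
  {within SFT M', continuous
    (fun y => \int[kappa y]_(x in fibre (SFT M) p y) f x)}.
Proof.
move=> fc; apply/within_continuous_cylinderP => y My e e0.
have e40 : 0 < e / 4 by lra.
have [N [phi Hphi]] := SFT_finitary_approx fc e40.
pose V := \sum_w `|phi w|.
have V0 : 0 <= V by apply: sumr_ge0.
(* The two approximations cost [e / 4] each, leaving [e / 2] for the weighted sum, which is at most
   [V * d]; the added 1 avoids a zero denominator. *)
pose d := e / (2 * (V + 1)).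
have d0 : 0 < d by apply: divr_gt0 => //; lra.
have ex w : exists n, forall y', SFT M' y' -> cylinder n y y' ->
    `|pr (kappa y) (first_word N @^-1` [set w]) -
      pr (kappa y') (first_word N @^-1` [set w])| <= d.
  have fw : is_finitary (first_word N @^-1` [set w]).
    by exists N; rewrite preimage_first_word; exact: finitary_cylinder.
  by have [n Hn] := kappa_continuous fw d0; exists n => y' My'; exact: Hn.
have [n Hn] := choice ex; exists (\max_w n w)%N => y' My' cy.
have mf := measurable_fun_continuous_SFT fc.
have := fibre_integral_approx mf (ltW e40) Hphi My.
have := fibre_integral_approx mf (ltW e40) Hphi My'.
set I := \int[_]_(_ in _) _; set I' := \int[_]_(_ in _) _.
set S := \sum_w _; set S' := \sum_w _ => IS IS'.
have SS : `|S' - S| <= e / 2.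
  rewrite /S /S' -sumrB; apply: le_trans (ler_norm_sum _ _ _) _.
  apply: (@le_trans _ _ (V * d)).
    rewrite mulr_suml; apply: ler_sum => w _; rewrite -mulrBr normrM.
    rewrite ler_wpM2l//; apply: Hn => // i iN; apply: cy.
    by apply: leq_trans iN _; exact: leq_bigmax.
  rewrite /d mulrA ler_pdivrMr; last lra.
  rewrite [leRHS](_ : _ = V * e + e); last by field.
  rewrite lerDl; exact: ltW.
move: IS IS' SS; rewrite !ler_norml => /andP[? ?] /andP[? ?] /andP[? ?].
by apply/andP; split; lra.
Qed.

End fibre_integral_continuity.

(** * The reversed chain and the g-function *)

Lemma measurable_preimage_shift (T : alphabetType) (V : set (seqspace T)) :
  measurable V -> measurable (@Defs.shift T @^-1` V).
Proof.
move: V; apply: finitary_induction.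
- by move=> C [n fC]; apply: (@finitary_measurable _ n.+1); exact: finitary_shift.
- by move=> C _ H; rewrite preimage_setC; exact: measurableC.
- by move=> F _ _ H; rewrite preimage_bigcup; exact: bigcup_measurable.
Qed.

Lemma measurable_shift (T : alphabetType) : measurable_fun setT (@Defs.shift T).
Proof. by move=> _ V mV; rewrite setTI; exact: measurable_preimage_shift. Qed.

Lemma measurable_coord (T : alphabetType) n (S : set T) :
  measurable [set x : seqspace T | S (x n)].
Proof. by apply: (@finitary_measurable _ n); exact: finitary_coord. Qed.

Section reversed_chain.
Variables (R : realType) (A : alphabetType).
Variables (P : A -> A -> R) (mu : probability (seqspace A) R) (q : A -> R).
Hypothesis stochP : stochastic P.
Hypothesis statq : stationary_vector P q.
Hypothesis q_gt0 : forall a, 0 < q a.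
Hypothesis mu_cyl : forall n w, mu (@cylinder A n w) =
  (q (w 0%N) * \prod_(i < n) P (w i) (w i.+1))%:E.

(* The transition probabilities of the time-reversed chain. *)
Definition back a c := q a * P a c / q c.

Lemma back_ge0 a c : 0 <= back a c.
Proof.
by rewrite /back divr_ge0 ?mulr_ge0//; [exact: ltW|exact: stochP.1|exact: ltW].
Qed.

Lemma back_sum c : \sum_a back a c = 1.
Proof.
rewrite -mulr_suml; have [_ _ ->] := statq.
by rewrite divff// gt_eqF.
Qed.

Let letter n a := [set x : seqspace A | x n = a].

Let mletter n a : measurable (letter n a).
Proof. exact: (@measurable_coord _ n [set a]). Qed.

Let cons_cyl a n (w : nat -> A) :
  letter 0 a `&` @Defs.shift A @^-1` cylinder n w = cylinder n.+1 (scons a w).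
Proof.
apply/seteqP; split => x; first by move=> [x0 cx] [|i] //; exact: cx.
by move=> cx; split => [|i ni]; [exact: cx|exact: (cx i.+1)].
Qed.

Let reversed_finitary a c n E : finitary n E ->
  mu (letter 0 a `&` @Defs.shift A @^-1` (E `&` letter 0 c)) =
  ((back a c)%:E * mu (E `&` letter 0 c))%E.
Proof.
move=> fE; pose F := E `&` letter 0 c.
have fF : finitary n F.
  apply: finitaryI => //; apply: (@finitary_le _ 0) => //.
  exact: (@finitary_coord _ _ [set c]).
have mF : measurable F by exact: finitary_measurable fF.
have mG : measurable (letter 0 a `&` @Defs.shift A @^-1` F).
  by apply: measurableI => //; apply: measurable_preimage_shift.
rewrite -/F (measure_partition mu mF (@measurable_first_word A n)).
rewrite (measure_partition mu (f := first_word n \o @Defs.shift A) mG); last first.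
  move=> w; rewrite comp_preimage; apply: measurable_preimage_shift.
  exact: measurable_first_word.
rewrite ge0_sume_distrr//; apply: eq_bigr => w _.
rewrite comp_preimage -setIA -preimage_setI preimage_first_word.
have [Fw|nFw] := pselect (F (pad w)); last first.
  have -> : F `&` cylinder n (pad w) = set0.
    by rewrite -subset0 => x [Fx cx]; apply: nFw; apply: fF Fx => i /cx.
  by rewrite preimage_set0 setI0 !measure0 mule0.
have -> : F `&` cylinder n (pad w) = cylinder n (pad w).
  by apply/setIidPr => x cx; apply: fF Fw => i /cx.
rewrite cons_cyl !mu_cyl -EFinM; congr EFin.
rewrite big_ord_recl /=; have [_ <-] := Fw; rewrite /back.
under eq_bigr do rewrite /bump leq0n add1n.
by field; rewrite gt_eqF.
Qed.

(** The Markov property read backwards: given [x 1 = c], the letter [x 0] is independent of the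
    future. Both sides are finite measures in [E] that agree on finitary sets. *)
Lemma reversed_chain a c E : measurable E ->
  mu (letter 0 a `&` @Defs.shift A @^-1` (E `&` letter 0 c)) =
  ((back a c)%:E * mu (E `&` letter 0 c))%E.
Proof.
move=> mE; have mS : measurable (letter 0 a `&` @Defs.shift A @^-1` letter 0 c).
  by apply: measurableI => //; apply: measurable_preimage_shift.
pose m0 : measure (seqspace A) R := pushforward (mrestr mu mS) (@Defs.shift A).
pose m1 := m0 (@measurable_shift A).
pose m2 : measure (seqspace A) R :=
  mscale (NngNum (back_ge0 a c)) (mrestr mu (mletter 0 c)).
have m1E F : m1 F =
    mu (letter 0 a `&` @Defs.shift A @^-1` (F `&` letter 0 c)).
  rewrite -[LHS]/(mu (@Defs.shift A @^-1` F `&` _)); congr (mu _).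
  by rewrite preimage_setI setICA.
rewrite -m1E -[RHS]/(m2 E).
apply: (measure_unique (@is_finitary A) (fun=> setT)) => //.
- exact: measurable_finitary.
- exact: is_finitary_setI.
- by move=> _; exact: is_finitary_setT.
- by rewrite bigcup_const//; exists 0%N.
- by move=> C [n fC]; rewrite m1E (reversed_finitary a c fC).
- by move=> _; rewrite m1E setTI ltey_eq fin_num_measure.
Qed.

Lemma reversed_chain_pred (S : pred A) E : measurable E ->
  pr mu ([set x | S (x 0%N)] `&` @Defs.shift A @^-1` E) =
  \sum_c (\sum_(a | S a) back a c) * pr mu (E `&` letter 0 c).
Proof.
move=> mE.
have mH : measurable ([set x : seqspace A | S (x 0%N)] `&` @Defs.shift A @^-1` E).
  apply: measurableI; first exact: (@measurable_coord _ 0 [set a | S a]).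
  by exact: measurable_preimage_shift.
rewrite (pr_partition mu (f := fun x : seqspace A => x 1%N) mH); last by move=> i; exact: mletter.
apply: eq_bigr => c _.
have mH' := measurableI _ _ mH (mletter 1 c).
rewrite (pr_partition mu (f := fun x : seqspace A => x 0%N) mH'); last by move=> i; exact: mletter.
rewrite mulr_suml [RHS]big_mkcond/=; apply: eq_bigr => a _.
case: ifPn => [Sa|nSa].
  rewrite /pr -[X in X * _]/(fine (back a c)%:E) -fineM//; last first.
    by rewrite fin_num_measure//; exact: measurableI.
  rewrite -reversed_chain//; congr (fine (mu _)).
  apply/seteqP; split => x /=; first by move=> [[[? ?] ?] ?].
  by move=> [xa [Ex xc]]; do !split => //=; rewrite xa.
rewrite (_ : _ `&` _ = set0) ?pr_set0// -subset0 => x /= [[[Sx _] _] xa].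
by rewrite xa (negPf nSa) in Sx.
Qed.

(** This is the reversed-chain identity with a free zeroth letter, since [back a c] sums to 1 over
    [a]. *)
Lemma stationary_shift E : measurable E -> mu (@Defs.shift A @^-1` E) = mu E.
Proof.
move=> mE; have mSE : measurable (@Defs.shift A @^-1` E).
  by exact: measurable_preimage_shift.
rewrite !prE//; congr EFin.
have := reversed_chain_pred predT mE.
rewrite [X in X `&` _](_ : _ = setT) ?setTI => [->|]; last exact/seteqP.
rewrite (pr_partition mu (f := fun x : seqspace A => x 0%N) mE); last by move=> i; exact: mletter.
by apply: eq_bigr => c _; rewrite back_sum mul1r.
Qed.

End reversed_chain.

(** * The image measure as a g-measure *)

Section g_measure.
Variables (R : realType) (A B : alphabetType) (M : rel A) (M' : rel B).
Variables (p : A -> B) (P : A -> A -> R) (mu : probability (seqspace A) R).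
Variable q : A -> R.
Hypothesis stochP : stochastic P.
Hypothesis compP : compatible P M.
Hypothesis statq : stationary_vector P q.
Hypothesis q_gt0 : forall a, 0 < q a.
Hypothesis mu_cyl : forall n w, mu (@cylinder A n w) =
  (q (w 0%N) * \prod_(i < n) P (w i) (w i.+1))%:E.
Hypothesis img : block_map p @` SFT M = SFT M'.
Hypothesis muM : mu (SFT M) = 1%E.
Variable kappa : seqspace B -> probability (seqspace A) R.
Hypothesis kappa_off : forall y, ~ SFT M' y -> kappa y = mu.
Hypothesis kappa_fib : forall y, SFT M' y -> kappa y (fibre (SFT M) p y) = 1%E.
Hypothesis kappa_lim : forall C, is_finitary C -> forall e, 0 < e ->
  exists n0, forall y, SFT M' y -> forall n, (n0 <= n)%N ->
    `|cond_ratio p mu C y n - pr (kappa y) C| <= e.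
Hypothesis kappa_pos : forall x, SFT M x ->
  0 < pr (kappa (block_map p x)) [set x' | x' 0%N = x 0%N].

Notation nu := (distribution mu (block_map p)).
Let letter a := [set x : seqspace A | x 0%N = a].

Let mletter a : measurable (letter a).
Proof. exact: (@measurable_coord _ 0 [set a]). Qed.

Let fletter a : is_finitary (letter a).
Proof. by exists 0%N; exact: (@finitary_coord _ _ [set a]). Qed.

Let kappa_cvg C y : is_finitary C -> SFT M' y ->
  cond_ratio p mu C y n @[n --> \oo] --> pr (kappa y) C.
Proof. by move=> fC My; exact: (kappa_cvg kappa_lim fC My). Qed.

Let mkappa := measurable_kappa kappa_off kappa_cvg.

(* [back_mass b c] is the probability of stepping back from [c] into the fibre
   over [b], and [cond_letter b y] is nu(y_0 = b | y_1 y_2 ... = y). *)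
Definition back_mass b c : R := \sum_(a | p a == b) back P q a c.

Definition cond_letter b y : R := \sum_c back_mass b c * pr (kappa y) (letter c).

Lemma back_mass_ge0 b c : 0 <= back_mass b c.
Proof. by apply: sumr_ge0 => a _; exact: back_ge0. Qed.

Lemma cond_letter_ge0 b y : 0 <= cond_letter b y.
Proof.
by apply: sumr_ge0 => c _; rewrite mulr_ge0 ?pr_ge0// back_mass_ge0.
Qed.

Lemma cond_letter_sum y : \sum_b cond_letter b y = 1.
Proof.
rewrite exchange_big/= -(pr_setT (kappa y)).
rewrite (pr_partition (kappa y) (f := fun x : seqspace A => x 0%N) measurableT);
  last by move=> c; exact: mletter.
apply: eq_bigr => c _; rewrite setTI -mulr_suml.
have -> : \sum_b back_mass b c = 1; last by rewrite mul1r.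
by rewrite -(back_sum statq q_gt0 c) (partition_big p xpredT).
Qed.

Lemma cond_letter_gt0 x : SFT M x ->
  0 < cond_letter (p (x 0%N)) (block_map p (@Defs.shift A x)).
Proof.
move=> Mx; apply: (@sumr_gt0 _ _ _ (x 1%N)).
  by move=> c; rewrite mulr_ge0 ?pr_ge0// back_mass_ge0.
rewrite mulr_gt0//; last by apply: (@kappa_pos (@Defs.shift A x)) => n; exact: Mx.
rewrite /back_mass (bigD1 (x 0%N))//= ltr_wpDr//.
  by apply: sumr_ge0 => a _; exact: back_ge0.
by rewrite /back divr_gt0// mulr_gt0//; apply/compP; exact: Mx.
Qed.

(** A nonzero term would give [a] over [b] with [M a c] and a fibre point starting at [c];
    prepending [a] would lift [scons b y]. Thus the sum over all letters in [cond_letter_sum]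
    reduces to the admissible ones. *)
Lemma cond_letter_eq0 b y : SFT M' y -> ~ SFT M' (scons b y) ->
  cond_letter b y = 0.
Proof.
move=> My nMby; rewrite /cond_letter big1// => c _.
apply/eqP; rewrite mulf_eq0; apply/norP => -[bc kc].
have [a [pa Pac]] : exists a, p a = b /\ M a c.
  apply: contrapT => /forallNP none; move: bc; rewrite /back_mass big1 ?eqxx// => a /eqP pa.
  apply/eqP; rewrite /back !mulf_eq0; apply/orP; left; apply/orP; right.
  rewrite eq_le (stochP.1 a c) andbT leNgt; apply/negP => /compP Mac.
  exact: (none a).
have [x [[Mx px] xc]] : fibre (SFT M) p y `&` letter c !=set0.
  apply/set0P; apply: contra kc => /eqP e.
  rewrite /pr -(measure_setI_full (measurable_fibre M p y) (mletter c) (kappa_fib My)).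
  by rewrite setIC e measure0.
apply: nMby; rewrite -img; exists (scons a x).
  by move=> [|n]; [rewrite /= xc|exact: Mx].
by apply/funext => -[|n]; [exact: pa|rewrite -px].
Qed.

Lemma shift_SFT (T : Type) (N : rel T) x : SFT N x -> SFT N (@Defs.shift T x).
Proof. by move=> Nx n; exact: Nx. Qed.

Lemma cond_letter_g_function :
  g_function (SFT M') (fun z => cond_letter (z 0%N) (@Defs.shift B z)).
Proof.
split.
- apply/within_continuous_cylinderP => z Mz e e0; have Mz' := shift_SFT Mz.
  pose V := \sum_c back_mass (z 0%N) c.
  have V0 : 0 <= V by apply: sumr_ge0 => c _; exact: back_mass_ge0.
  pose d := e / (V + 1).
  have d0 : 0 < d by apply: divr_gt0 => //; lra.
  have ex c : exists n, forall y', SFT M' y' -> cylinder n (@Defs.shift B z) y' ->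
      `|pr (kappa (@Defs.shift B z)) (letter c) - pr (kappa y') (letter c)| <= d.
    have [n Hn] := kappa_continuous kappa_lim (fletter c) d0.
    by exists n => y' My'; exact: Hn.
  (* The successor accounts for the shift: coordinate [i] of the shifted sequence is coordinate
     [i + 1] of [z]. *)
  have [n Hn] := choice ex; exists (\max_c n c).+1 => z' Mz1 cz.
  have -> : z' 0%N = z 0%N by exact: cz.
  rewrite /cond_letter -sumrB; apply: le_trans (ler_norm_sum _ _ _) _.
  apply: (@le_trans _ _ (V * d)).
    rewrite mulr_suml; apply: ler_sum => c _; rewrite -mulrBr normrM.
    rewrite ger0_norm ?back_mass_ge0// ler_wpM2l ?back_mass_ge0//.
    apply: Hn; first exact: shift_SFT.
    move=> i ic; apply: (cz i.+1); rewrite ltnS; apply: leq_trans ic _.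
    exact: leq_bigmax.
  rewrite /d mulrA ler_pdivrMr; last lra.
  by rewrite mulrDr mulr1 mulrC lerDl ltW.
- move=> z Mz; apply/andP; split.
    move: Mz; rewrite -img => -[x Mx <-]; exact: cond_letter_gt0.
  rewrite -[leRHS](cond_letter_sum (@Defs.shift B z)) (bigD1 (z 0%N))//=.
  by rewrite lerDl sumr_ge0// => b _; exact: cond_letter_ge0.
- move=> y My; rewrite -[RHS](cond_letter_sum y) [LHS]big_mkcond/=.
  apply: eq_bigr => b _; case: ifPn => //.
  by rewrite notin_setE => nM; rewrite cond_letter_eq0.
Qed.

Lemma measurable_cond_letter b : measurable_fun setT (cond_letter b).
Proof.
apply: measurable_sum => c; apply: measurable_funM => //.
apply/measurable_EFinP; apply: (eq_measurable_fun (fun y => kappa y (letter c))).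
  by move=> y _; rewrite /= prE.
exact: mkappa.
Qed.

Lemma nu_translation_invariant : translation_invariant nu.
Proof.
move=> C mC.
have mpC : measurable (block_map p @^-1` C).
  by rewrite -[X in measurable X]setTI; exact: measurable_block_map.
exact: (stationary_shift stochP statq q_gt0 mu_cyl mpC).
Qed.

(** As [kappa y] lives on the fibre over [y], the preimage of [D] has full or zero mass according to
    whether [y] lies in [D]. *)
Lemma integral_kappa_setI D c : measurable D ->
  (\int[nu]_(y in D) kappa y (letter c) = mu (block_map p @^-1` D `&` letter c))%E.
Proof.
move=> mD; have mS' := measurable_SFT M'.
have mpD : measurable (block_map p @^-1` D).
  by rewrite -[X in measurable X]setTI; exact: measurable_block_map.
have mE := measurableI _ _ mpD (mletter c).
have nuS := nu_SFT img muM.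
transitivity (\int[nu]_y kappa y (block_map p @^-1` D `&` letter c))%E; last first.
  pose h x : \bar R := (\1_(block_map p @^-1` D `&` letter c) x)%:E.
  have mh : measurable_fun setT h by apply/measurable_EFinP; exact: measurable_indic.
  have h0 x : (0 <= h x)%E by rewrite lee_fin.
  have := integral_kappa_ge0 img muM kappa_off kappa_cvg mh h0.
  rewrite [X in _ = X -> _]integral_indic// setIT => <-.
  by apply: eq_integral => y _; rewrite integral_indic// setIT.
rewrite integral_mkcond -[RHS](integral_full mS' nuS); last exact: mkappa.
rewrite -[LHS](integral_full mS' nuS); last first.
  by apply/measurable_restrict => //; rewrite setTI; apply: measurable_funTS; exact: mkappa.
apply: eq_integral => y; rewrite inE => My; rewrite patchE.
have full E : measurable E -> kappa y (E `&` fibre (SFT M) p y) = kappa y E.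
  by move=> mE'; exact: measure_setI_full (measurable_fibre M p y) mE' (kappa_fib My).
rewrite -[RHS]full//; case: ifPn; rewrite ?inE ?notin_setE => yD.
  rewrite -[LHS]full//; congr (kappa y _); apply/seteqP; split => x.
    by move=> [xc [Mx px]]; do !split => //; rewrite /= px.
  by move=> [[_ xc] f]; split.
rewrite (_ : _ `&` _ = set0) ?measure0// -subset0 => x [[/= xD _] [_ px]].
by apply: yD; rewrite -px.
Qed.

(** The test sets are shift preimages of some [D]. Invariance of [nu] removes the shift from the
    integral, and the reversed chain reassembles the sum over [c] into the event that [x 0] lies
    over [b] and the shifted point over [D]. *)
Lemma cond_letter_cond_prob b : cond_prob nu (@Defs.shift B)
  [set y | y 0%N = b] (cond_letter b \o @Defs.shift B).
Proof.
have mG := measurable_cond_letter b.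
have mGs : measurable_fun setT (cond_letter b \o @Defs.shift B).
  exact: measurableT_comp (@measurable_shift B).
have le1 y : cond_letter b y <= 1.
  rewrite -(cond_letter_sum y) (bigD1 b)//= lerDl.
  by apply: sumr_ge0 => b' _; exact: cond_letter_ge0.
split.
- move=> _ V mV; rewrite setTI; exists (cond_letter b @^-1` V); last by rewrite setTI.
  by rewrite -[X in measurable X]setTI; exact: mG.
- apply: (le_integrable measurableT _ _
    (finite_measure_integrable_cst nu 1 measurableT)).
    exact/measurable_EFinP.
  by move=> y _ /=; rewrite lee_fin normr1 ger0_norm ?cond_letter_ge0.
move=> _ [D mD <-]; rewrite setTI.
have mpD : measurable (block_map p @^-1` D).
  by rewrite -[X in measurable X]setTI; exact: measurable_block_map.
transitivity (\int[nu]_(y in D) (cond_letter b y)%:E)%E.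
  have := @ge0_integral_pushforward _ _ _ _ R _ (@measurable_shift B) nu D
    (EFin \o cond_letter b) mD.
  move=> /(_ _ _)/esym H; rewrite [LHS]H; last 2 first.
  - by apply/measurable_EFinP; exact: measurable_funTS.
  - by move=> y _; rewrite /= lee_fin cond_letter_ge0.
  apply: eq_measure_integral => [|? C mC _]; first exact: measurable_shift.
  exact: nu_translation_invariant.
transitivity (\int[nu]_(y in D) \sum_c ((back_mass b c)%:E * kappa y (letter c)))%E.
  apply: eq_integral => y _; rewrite /= /cond_letter -sumEFin.
  by apply: eq_bigr => c _; rewrite prE.
have mk c : measurable_fun D (fun y => kappa y (letter c)).
  by apply: measurable_funTS; exact: mkappa.
rewrite ge0_integral_sum//; last 2 first.
- by move=> c; exact: measurable_funeM.
- by move=> c y _; rewrite mule_ge0// lee_fin back_mass_ge0.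
transitivity (\sum_c (back_mass b c * pr mu (block_map p @^-1` D `&` letter c))%:E)%E.
  apply: eq_bigr => c _; rewrite ge0_integralZl_EFin ?back_mass_ge0//.
  by rewrite integral_kappa_setI// prE//; exact: measurableI.
rewrite sumEFin -(reversed_chain_pred stochP q_gt0 mu_cyl (fun a => p a == b) mpD).
rewrite -prE; last first.
  apply: measurableI; last exact: measurable_preimage_shift.
  exact: (@measurable_coord _ 0 [set a | p a == b]).
congr (mu _); apply/seteqP; split => x /= [e ?]; split => //; exact/eqP.
Qed.

Lemma nu_g_measure : g_measure (SFT M') nu.
Proof.
split; [exact: nu_SFT img muM|exact: nu_translation_invariant|].
exists (fun z => cond_letter (z 0%N) (@Defs.shift B z)).
  exact: cond_letter_g_function.
exists (fun b => cond_letter b \o @Defs.shift B); split.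
  exact: cond_letter_cond_prob.
(* The chosen version of the conditional probability coincides with [g] at every point. *)
exact: aeW.
Qed.

End g_measure.

Theorem corollary4p16 (R : realType) (A B : alphabetType)
  (M : rel A) (M' : rel B) (p : A -> B)
  (P : A -> A -> R) (mu : probability (seqspace A) R) :
  (#|B| < #|A|)%N ->
  set_surj [set: A] [set: B] p ->
  primitive M -> primitive M' ->
  block_map p @` SFT M = SFT M' ->
  fibre_mixing (SFT M) p ->
  compatible P M ->
  mu (SFT M) = 1%E -> stationary_markov mu P ->
  (exists mu_ : seqspace B -> probability (seqspace A) R,
      continuous_disintegration p (SFT M) (SFT M') mu mu_) /\
  g_measure (SFT M') (distribution mu (block_map p)).
Proof.
move=> _ _ primM _ img mix compP muM [stochP [q statq mu_cyl]].
have q0 := stationary_vector_gt0 stochP compP statq primM.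
have [N rectN] := fibre_mixing_rectangle_time mix.
have wpos x n (Mx : SFT M x) := window_gt0 p stochP compP statq mu_cyl primM n Mx.
have [l Hl] := ratio_limit stochP compP statq mu_cyl primM rectN.
have [kappa [koff klim]] := fibre_kernel_exists wpos img Hl.
have kfib := kappa_fibre wpos img muM klim.
have kcvg C y := @kappa_cvg _ _ _ M' p mu kappa klim C y.
split.
  exists kappa; split; first exact: (kappa_disintegration img muM koff kfib kcvg).
  exact: (fibre_integral_continuous kfib klim).
apply: (nu_g_measure stochP compP statq q0 mu_cyl img muM koff kfib klim) => x Mx.
(* A positive bound below all late ratios survives in the limit, so [kappa] charges the initial
   letter of each fibre point. *)
have [r r0 Hr] := ratio_coord_lower_bound stochP compP statq mu_cyl primM rectN Mx.
have fx : is_finitary [set x' : seqspace A | x' 0%N = x 0%N].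
  by exists 0%N; exact: (@finitary_coord _ _ [set x 0%N]).
have My : SFT M' (block_map p x) by rewrite -img; exists x.
have /cvg_lim <- // := kcvg _ _ fx My.
apply: lt_le_trans r0 _; apply: limr_ge; first exact: cvgP (kcvg _ _ fx My).
by exists N => // n /= Nn; exact: Hr.
Qed.
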